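(* Let $k \geq 3$ and $1 \leq d \leq k/2$ be integers. Then, for $n$ divisible by $k$, $$m_d(k,n) \leq \left(1 - \frac{7}{50} + o_n(1)\right)\binom{n-d}{k-d},$$ where $o_n(1)$ denotes a function (for fixed $k$ and $d$) tending to $0$ as $n \to \infty$ through multiples of $k$. Equivalently: for every $\varepsilon > 0$ there exists $n_0 = n_0(k,d,\varepsilon)$ such that $m_d(k,n) \leq \left(\frac{43}{50} + \varepsilon\right)\binom{n-d}{k-d}$ for every $n \geq n_0$ divisible by $k$.
   Context: A $k$-uniform hypergraph ($k$-graph) $H=(V,E)$ consists of a finite vertex set $V=V(H)$ and a family $E=E(H)\subseteq \binom{V}{k}$ of $k$-element subsets of $V$, called edges. For $S \subseteq V$ with $0 \leq |S| \leq k-1$, $\deg_H(S) := |\{e \in E(H) : S \subseteq e\}|$. For $0\le d\le k-1$, the minimum $d$-degree of $H$ is $\delta_d(H) := \min\{\deg_H(S) : S \in \binom{V(H)}{d}\}$. A matching in $H$ is a collection of pairwise vertex-disjoint edges; its size is its number of edges. A perfect matching is a matching of size $|V|/k$ (so $k$ must divide $|V|$). For integers $k,d$ with $0\le d\le k-1$ and $n$ divisible by $k$, $m_d(k,n)$ denotes the smallest integer $m$ such that every $n$-vertex $k$-graph $H$ with $\delta_d(H) \geq m$ contains a perfect matching. *)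

(* Defs.v *)
From mathcomp Require Import all_boot all_order all_algebra.
From mathcomp Require Import boolp reals.

Set Implicit Arguments.
Unset Strict Implicit.
Unset Printing Implicit Defensive.

Record kgraph (k : nat) := KGraph {
  vert : finType;
  edges : {set {set vert}};
  edges_card : forall e, e \in edges -> #|e| = k
}.

Definition deg (k : nat) (H : kgraph k) (S : {set vert H}) : nat :=
  #|[set e in edges H | S \subset e]|.

(* Since deg S <= #|edges H| for every S, the default value of the iterated
   minimum does not affect the result as soon as there is a vertex set of
   size d, i.e. d <= #|vert H|; otherwise the value is the junk #|edges H|. *)
Definition mindeg (k d : nat) (H : kgraph k) : nat :=
  \big[minn/#|edges H|]_(S : {set vert H} | #|S| == d) deg S.

Definition matching (k : nat) (H : kgraph k) (M : {set {set vert H}}) : bool :=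
  (M \subset edges H) && trivIset M.

(* The size condition is #|M| = #|V| / k without rounding, so that it forces
   k to divide #|V|. *)
Definition perfect_matching (k : nat) (H : kgraph k)
    (M : {set {set vert H}}) : bool :=
  matching M && (#|M| * k == #|vert H|).

Definition forces_pm (d k n m : nat) : Prop :=
  forall H : kgraph k, #|vert H| = n -> m <= mindeg d H ->
    exists M : {set {set vert H}}, perfect_matching M.

(* Satisfied vacuously by m = 2 ^ (2 ^ n): no n-vertex
   k-graph has minimum degree at least m. *)
Lemma forces_pm_ex (d k n : nat) : exists m, `[< forces_pm d k n m >].
Proof.
exists (2 ^ (2 ^ n)); apply/asboolP => H Hn.
have le_md : mindeg d H <= #|edges H|.
  rewrite /mindeg; elim/big_ind: _ => //.
    by move=> x y Hx _; apply: leq_trans (geq_minl _ _) Hx.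
  by move=> S _; apply/subset_leq_card/subsetP => e; rewrite inE => /andP[].
have le_e : #|edges H| <= 2 ^ n.
  by rewrite -Hn -cardsT -card_powerset; apply: subset_leq_card;
     apply/subsetP => e _; rewrite powersetE subsetT.
by move=> /leq_trans/(_ (leq_trans le_md le_e)); rewrite leqNgt ltn_expl.
Qed.

(* This is m_d(k,n); the minimum is taken over natural numbers, which loses
   nothing because mindeg is nonnegative. *)
Definition m_deg (d k n : nat) : nat := ex_minn (forces_pm_ex d k n).

(* Main.v *)
Require Import Defs.
From mathcomp Require Import boolp classical_sets reals topology normedtype.
From mathcomp Require Import function_spaces sequences derive realfun exp.
From mathcomp Require Import all_boot all_order all_algebra.
From mathcomp Require Import ring lra zify.

(* Double counting reduces the claim to d = 1 with every vertex degree a little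
   above 43/50 of its maximum.  A family of disjoint absorbers, chosen greedily
   so as to decrease the sum of 2^-(number of absorbers of x), absorbs any small
   leftover set, so an almost perfect matching is enough.

   If a maximum matching left many vertices uncovered, then averaging would give
   one dense pattern of edges (an uncovered vertex together with prescribed
   positions in t edges of the matching) shared by many pairs of a t-tuple of
   edges and an uncovered vertex, hence by all tuples of a large box.  Inside the
   box some tq edges of the matching can be replaced by tq + 1 disjoint edges, as
   soon as tq + 1 edges of the pattern can be chosen with no position used more
   than q times.  Blackwell's approachability strategy chooses them, provided that
   for all nonnegative weights on the positions some edge of the pattern weighs
   clearly less than a full row on average.  As the pattern has density above
   43/50, this follows from an inequality in the spirit of Feige: the sum of m
   independent copies of a nonnegative variable of mean 1 is below m + 49/50 with
   probability at least 7/50.  Markov suffices for m <= 6.  For larger m the law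
   is tilted so that the threshold lies at tilted deviation 3, and the indicator
   of the event is bounded from below by the exponential times a quartic, whose
   tilted mean only involves four moments. *)

Set Implicit Arguments.
Unset Strict Implicit.
Unset Printing Implicit Defensive.

(** * Enlarging a matching with a balanced sequence of pattern edges *)

(** The extra edge is possible because each new edge takes one vertex from outside the matching:
    [t q + 1] edges need only [r (t q + 1)] of the [t q (r + 1)] positions in the traded rows. The
    danger is that some positions are overused, and the dual obstruction is a weighting of the
    positions under which every pattern edge is heavy. For a random [r]-tuple of positions this is a
    small deviation event with threshold [r + 1]. Asking for [r + 98/100] leaves a gap of [2/100],
    whose linear drift has to beat the square-root error of the approachability strategy. Markov's
    inequality gives [(98/100) / (m + 98/100)], which is 0.1404 for [m = 6] but 0.1228 for [m = 7].
    In the tilted argument the critical regime is small [t] and large [m]. There the normalisation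
    is about [e^(3/2)], and the available lower bound for the mean of the quartic is about 2/3 at
    both extremes of the tilted variance, 0 and 3. The limit is thus [(2/3) e^(-3/2) = 0.1487...],
    and [7/50] leaves room for the corrections in [t] and [1/m]. *)

Definition load (X : finType) (r : nat) (H : seq {ffun 'I_r -> X}) (x : X) : nat :=
  \sum_(h <- H) #|[set i | h i == x]|.

Lemma load_rcons (X : finType) (r : nat) (H : seq {ffun 'I_r -> X}) h x :
  load (rcons H h) x = load H x + #|[set i | h i == x]|.
Proof. by rewrite /load big_rcons /= addnC. Qed.

Lemma load_take_leq (X : finType) (r : nat) (H : seq {ffun 'I_r -> X}) x j :
  load (take j H) x <= load H x.
Proof. by rewrite -[in leqRHS](cat_take_drop j H) /load big_cat leq_addr. Qed.

Lemma load_take_lt (X : finType) (r : nat) (H : seq {ffun 'I_r -> X}) h0 x i j j' :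
  j < j' -> j < size H -> nth h0 H j i = x ->
  load (take j H) x < load (take j' H) x.
Proof.
move=> lt_jj' lt_jH hx; apply: (@leq_trans (load (take j.+1 H) x)).
  rewrite (take_nth h0) // load_rcons -addn1 leq_add2l card_gt0.
  by apply/set0Pn; exists i; rewrite inE hx.
by rewrite -(take_takel H lt_jj'); apply: load_take_leq.
Qed.

(* At most [t (q + 1)] edges of [M] meet the boxes; they are traded for the
   [t (q + 1) + 1] edges given by [H], where the [j]-th edge realises the
   position [x] in the copy numbered by the earlier uses of [x]. *)
Lemma swap_matching (V : finType) (r p t q : nat) (E M : {set {set V}})
    (lab : 'I_p * 'I_r.+1 -> V) (Q : {ffun 'I_t -> {ffun 'I_q.+1 -> 'I_p}})
    (Y : {set V}) (H : seq {ffun 'I_r -> 'I_t * 'I_r.+1}) :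
  let row j := [set lab (j, a) | a : 'I_r.+1] in
  injective lab -> M \subset E -> trivIset M ->
  (forall e, e \in M -> exists j, e = row j) ->
  (forall s s' c c', Q s c = Q s' c' -> s = s' /\ c = c') ->
  (t * q.+1 * r.+1 + t * q.+1 < #|Y|) -> [disjoint Y & cover M] ->
  size H = (t * q.+1).+1 ->
  (forall h, h \in H -> injective (fun i => (h i).1)) ->
  (forall x, load H x <= q.+1) ->
  (forall y h (g : {ffun 'I_t -> 'I_q.+1}), y \in Y -> h \in H ->
     y |: [set lab (Q (h i).1 (g (h i).1), (h i).2) | i : 'I_r] \in E) ->
  exists M' : {set {set V}}, [/\ M' \subset E, trivIset M' & #|M| < #|M'|].
Proof.
move=> row lab_inj ME trM Mrow Qinj Ybig YM sH H_inj H_load YE.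
pose Rows := [set row (Q sc.1 sc.2) | sc : 'I_t * 'I_q.+1].
have Rows_le : #|Rows| <= t * q.+1.
  by apply: leq_trans (leq_imset_card _ _) _; rewrite card_prod !card_ord.
have cRows_le : #|cover Rows| <= t * q.+1 * r.+1.
  apply: leq_trans (leq_card_cover _) _.
  apply: leq_trans (_ : \sum_(e in Rows) r.+1 <= _).
    apply: leq_sum => e /imsetP[sc _ ->].
    by apply: leq_trans (leq_imset_card _ _) _; rewrite card_ord.
  by rewrite sum_nat_const leq_mul2r Rows_le orbT.
(* [Y] avoids the edges of [M] but may meet rows that are not edges of [M]; the first summand in the
   lower bound on [#|Y|] pays for discarding these vertices. *)
pose Y' := Y :\: cover Rows.
have Y'_gt : t * q.+1 < #|Y'|.
  have := cardsID (cover Rows) Y; rewrite -/Y'.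
  have : #|Y :&: cover Rows| <= #|cover Rows| by rewrite subset_leq_card ?subsetIr.
  lia.
have [y0 _] : exists y0, y0 \in Y' by apply/set0Pn; rewrite -card_gt0; lia.
have [h0 _] : exists h0, h0 \in H by case: (H) sH => // h H' _; exists h; rewrite mem_head.
pose n := (t * q.+1).+1.
pose y (j : 'I_n) := nth y0 (enum Y') j.
have yY' j : y j \in Y'.
  by rewrite -mem_enum mem_nth // -cardE; case: j => j /=; rewrite /n; lia.
have yY j : y j \in Y by have := yY' j; rewrite inE => /andP[].
have y_inj : injective y.
  move=> j j' /eqP; rewrite nth_uniq ?enum_uniq -?cardE //.
  - by move=> /eqP/val_inj.
  - by have := ltn_ord j; rewrite /n; lia.
  - by have := ltn_ord j'; rewrite /n; lia.
have yM j e : e \in M -> y j \notin e.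
  move=> eM; have /disjointFr/(_ (yY j))/negbT := YM.
  by apply: contra => ye; apply/bigcupP; exists e.
have yRows j sc : y j \notin row (Q sc.1 sc.2).
  have := yY' j; rewrite inE => /andP[+ _]; apply: contra => yr.
  by apply/bigcupP; exists (row (Q sc.1 sc.2)) => //; apply/imsetP; exists sc.
pose h (j : 'I_n) := nth h0 H j.
have hH j : h j \in H by rewrite mem_nth // sH.
pose l (j : 'I_n) x := load (take j H) x.
have l_lt (j : 'I_n) i : l j (h j i) < q.+1.
  apply: leq_trans (H_load (h j i)).
  rewrite -[X in _ < load X _](take_size H); apply: (load_take_lt (h0 := h0)) => //.
    by rewrite sH.
  by rewrite sH.
(* By [H_inj] an edge uses each block [s] at most once, so choosing a copy for each of its positions
   amounts to one index per block; [ord0] is the default for blocks it does not meet. *)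
pose g (j : 'I_n) : {ffun 'I_t -> 'I_q.+1} := [ffun s =>
  if [pick i | (h j i).1 == s] is Some i then inord (l j (h j i)) else ord0].
have gE j i : g j (h j i).1 = inord (l j (h j i)).
  rewrite ffunE; case: pickP => [i' /eqP eq_i|/(_ i)]; last by rewrite eqxx.
  by rewrite (H_inj _ (hH j) _ _ eq_i).
pose e j := y j |: [set lab (Q (h j i).1 (g j (h j i).1), (h j i).2) | i : 'I_r].
have eE j : e j \in E by apply: YE.
have e_sub j x : x \in e j -> x = y j \/
    exists2 i, x = lab (Q (h j i).1 (inord (l j (h j i))), (h j i).2) &
      x \in row (Q (h j i).1 (inord (l j (h j i)))).
  rewrite !inE => /predU1P[->|/imsetP[i _ ->]]; [by left|right].
  by exists i; rewrite gE //; apply/imsetP; exists (h j i).2.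
have row_inj a b x : x \in row a -> x \in row b -> a = b.
  by move=> /imsetP[c _ ->] /imsetP[d _ /lab_inj[->]].
have e_disj_lt (j j' : 'I_n) x : j < j' -> x \in e j -> x \in e j' -> False.
  move=> lt_jj' /e_sub[->|[i xE xr]] /e_sub[|[i' xE' xr']].
  - by move=> /y_inj jj'; rewrite jj' ltnn in lt_jj'.
  - by move: xr'; apply/negP; apply: (yRows j (_, _)).
  - by move=> xy; move: xr; apply/negP; rewrite xy; apply: (yRows j' (_, _)).
  move: xE'; rewrite xE => /lab_inj[/Qinj[eq1 eq2] eq3].
  have hh : h j i = h j' i' by rewrite [LHS]surjective_pairing [RHS]surjective_pairing eq1 eq3.
  have := load_take_lt (H := H) (h0 := h0) (x := h j i) (i := i) lt_jj'.
  rewrite sH => /(_ (ltn_ord j) erefl); rewrite -/(l j (h j i)) -/(l j' (h j i)).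
  by move: eq2 => /(congr1 (@nat_of_ord _)); rewrite !inordK // {2}hh -hh => ->; rewrite hh ltnn.
have e_disj (j j' : 'I_n) : j != j' -> [disjoint e j & e j'].
  move=> jj'; rewrite -setI_eq0; apply/eqP/setP => x; rewrite in_set0 in_setI.
  apply/negP => /andP[xj xj'].
  move: jj'; rewrite neq_ltn => /orP[lt|lt]; first exact: (e_disj_lt _ _ _ lt xj xj').
  exact: (e_disj_lt _ _ _ lt xj' xj).
have e_inj : injective e.
  move=> j j' ee; apply/eqP; apply: contraT => /e_disj; rewrite ee -setI_eq0 setIid.
  by move/eqP/setP/(_ (y j')); rewrite !inE eqxx.
have eM j : e j \notin M.
  by apply/negP => /(yM j); rewrite !inE eqxx.
have eM_disj j f : f \in M -> f \notin Rows -> [disjoint e j & f].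
  move=> fM fR; rewrite -setI_eq0; apply/eqP/setP => x; rewrite in_set0 in_setI.
  apply/negP => /andP[/e_sub[->|[i _ xr]] xf]; first by rewrite (negbTE (yM j f fM)) in xf.
  have [j' fE] := Mrow f fM; rewrite fE in xf fR.
  move/negP: fR; apply; rewrite (row_inj _ _ _ xf xr).
  by apply/imsetP; exists ((h j i).1, inord (l j (h j i))).
exists ((M :\: Rows) :|: [set e j | j : 'I_n]); split.
- rewrite subUset (subset_trans (subsetDl _ _) ME) /=.
  by apply/subsetP => _ /imsetP[j _ ->].
- apply/trivIsetP => A B; rewrite !inE => /orP[/andP[AR AM]|/imsetP[j _ ->]].
    move=> /orP[/andP[BR BM]|/imsetP[j _ ->]] AB; first exact: (trivIsetP trM).
    by rewrite disjoint_sym; apply: eM_disj.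
  move=> /orP[/andP[BR BM]|/imsetP[j' _ ->]] AB; first exact: eM_disj.
  by apply: e_disj; apply: contraNneq AB => ->.
rewrite cardsU (_ : _ :&: _ = set0) ?cards0 ?subn0.
  rewrite card_imset // card_ord.
  have := cardsID Rows M.
  have : #|M :&: Rows| <= #|Rows| by rewrite subset_leq_card ?subsetIr.
  by move=> le1 <-; rewrite addnC ltn_add2l ltnS (leq_trans le1).
apply/setP => A; rewrite in_set0 in_setI; apply/negP => /andP[AM /imsetP[j _ AE]].
by move: AM; rewrite AE inE (negbTE (eM j)) andbF.
Qed.

Lemma size_flatten_const (T : Type) (k : nat) (ss : seq (seq T)) :
  (all (fun s => size s == k) ss) -> size (flatten ss) = size ss * k.
Proof. by elim: ss => //= s ss IH /andP[/eqP sk /IH ssk]; rewrite size_cat sk ssk. Qed.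

Lemma nth_flatten_const (T : Type) (x0 : T) (k : nat) (ss : seq (seq T)) j a :
  (all (fun s => size s == k) ss) -> j < size ss -> a < k ->
  nth x0 (flatten ss) (j * k + a) = nth x0 (nth [::] ss j) a.
Proof.
elim: ss j => //= s ss IH [|j] /andP[/eqP sk ssk] lt_j lt_a; rewrite nth_cat sk.
  by rewrite lt_a.
by rewrite mulSn -addnA ltnNge leq_addr /= addKn; apply: IH.
Qed.

(** The vertices outside [M] are grouped into rows as well. By cardinality [lab] is then a
    bijection, so that degrees become exact sums over labels, and trading a row that is not an edge
    of [M] costs nothing. *)
Lemma matching_rows (V : finType) (r p : nat) (M : {set {set V}}) :
  trivIset M -> (forall e, e \in M -> #|e| = r.+1) -> #|V| = p * r.+1 ->
  exists2 lab : 'I_p * 'I_r.+1 -> V, injective lab &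
    forall e, e \in M -> exists j, e = [set lab (j, a) | a : 'I_r.+1].
Proof.
move=> trM Mk cardV; have [V0|V_gt0] := posnP #|V|.
  have p0 : p = 0 by move: cardV; rewrite V0 => /esym/eqP; rewrite muln_eq0 orbF => /eqP.
  subst p; have lab : 'I_0 * 'I_r.+1 -> V by case=> -[].
  exists lab; first by case=> -[].
  by move=> e /Mk e_card; have := max_card (mem e); rewrite V0 e_card.
have /card_gt0P[x0 _] := V_gt0.
pose ss := [seq enum (e : {set V}) | e <- enum M].
pose s := flatten ss ++ enum (~: cover M).
have ssk : all (fun u => size u == r.+1) ss.
  by apply/allP => _ /mapP[e + ->]; rewrite mem_enum -cardE => /Mk ->.
have cardM : #|cover M| = #|M| * r.+1.
  rewrite -(eqP trM) (eq_bigr (fun=> r.+1)) ?sum_nat_const //.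
have size_s : size s = #|V|.
  rewrite size_cat (size_flatten_const ssk) size_map -!cardE -cardM.
  by rewrite cardsC.
have s_all v : v \in s.
  rewrite mem_cat mem_enum inE; 
  have [/bigcupP[e eM v_e]|_] := boolP (v \in cover M); last by rewrite orbT.
  rewrite orbF; apply/flattenP; exists (enum e); last by rewrite mem_enum.
  by apply/mapP; exists e => //; rewrite mem_enum.
have s_uniq : uniq s.
  apply: (leq_size_uniq (enum_uniq V)); first by move=> w _; exact: s_all.
  by rewrite size_s cardT.
pose lab (x : 'I_p * 'I_r.+1) := nth x0 s (x.1 * r.+1 + x.2).
have lt_s (j : 'I_p) (a : 'I_r.+1) : j * r.+1 + a < size s.
  rewrite size_s cardV; apply: (@leq_trans (j.+1 * r.+1)).
    by rewrite mulSn addnC ltn_add2r ltn_ord.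
  by rewrite leq_mul2r ltn_ord orbT.
exists lab.
  move=> [j a] [j' a'] /eqP; rewrite /lab nth_uniq ?lt_s //= => /eqP eq_ja.
  have := congr1 (fun n => n %/ r.+1) eq_ja.
  rewrite !divnMDl // !divn_small ?ltn_ord // !addn0 => /val_inj ->.
  have := congr1 (fun n => n %% r.+1) eq_ja.
  by rewrite !modnMDl !modn_small ?ltn_ord // => /val_inj ->.
move=> e eM; pose j := index e (enum M).
have lt_j : j < #|M| by rewrite cardE index_mem mem_enum.
have lt_jp : j < p.
  rewrite -(ltn_pmul2r (ltn0Sn r)) -cardV; apply: leq_trans (max_card (mem (cover M))).
  by rewrite cardM ltn_pmul2r.
have labE (a : 'I_r.+1) : lab (Ordinal lt_jp, a) = nth x0 (enum e) a.
  rewrite /lab /= nth_cat (size_flatten_const ssk) size_map -cardE.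
  have -> : j * r.+1 + a < #|M| * r.+1.
    apply: (@leq_trans (j.+1 * r.+1)); last by rewrite leq_mul2r lt_j orbT.
    by rewrite mulSn addnC ltn_add2r ltn_ord.
  rewrite (nth_flatten_const x0 ssk) ?size_map -?cardE //.
  by rewrite (nth_map set0) -?cardE // /j nth_index // mem_enum.
exists (Ordinal lt_jp); apply/setP => v; apply/idP/imsetP => [ve|[a _ ->]].
  have lt_v : index v (enum e) < r.+1 by rewrite -(Mk e eM) cardE index_mem mem_enum.
  by exists (Ordinal lt_v) => //; rewrite labE nth_index // mem_enum.
by rewrite labE -mem_enum mem_nth // -cardE (Mk e eM).
Qed.

Import Order.TTheory GRing.Theory Num.Theory.
Import numFieldNormedType.Exports.
Local Open Scope ring_scope.

(** * Bounds on the exponential *)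

Lemma nincr_from_0 (R : realType) (f df : R -> R) (x : R) :
  (forall y : R, is_derive y (1 : R) f (df y)) -> (forall y, 0 < y -> df y <= 0) ->
  0 <= x -> f x <= f 0.
Proof.
move=> Df df_le0; rewrite le_eqVlt => /predU1P[<-//|x_gt0].
have cf : {within `[0, x], continuous f}%classic.
  apply: continuous_subspaceT => y.
  by apply/differentiable_continuous/derivable1_diffP; apply: ex_derive.
have [c] := MVT x_gt0 (fun y _ => Df y) cf.
rewrite in_itv/= => /andP[c_gt0 _] fE.
by rewrite -subr_le0 fE subr0 pmulr_lle0 // df_le0.
Qed.

(** The hypothesis says that [expR (- c * x) * p.[x]] has nonpositive derivative (Gronwall). *)
Lemma horner_le_expR (R : realType) (p : {poly R}) (c x : R) :
  (forall y, 0 < y -> (p^`()).[y] <= c * p.[y]) ->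
  0 <= x -> p.[x] <= p.[0] * expR (c * x).
Proof.
move=> dp_le x_ge0.
pose f (y : R) := expR (- c * y) * p.[y].
pose df (y : R) := expR (- c * y) * ((p^`()).[y] - c * p.[y]).
have Df (y : R) : is_derive y (1 : R) f (df y).
  rewrite /f; apply: is_derive_eq.
  by rewrite /df /GRing.scale /=; ring.
have : f x <= f 0.
  apply: (@nincr_from_0 _ _ df) => // y y_gt0.
  by rewrite pmulr_rle0 ?expR_gt0 // subr_le0 dp_le.
by rewrite /f mulr0 expR0 mul1r mulNr expRN mulrC ler_pdivrMr ?expR_gt0.
Qed.

Lemma expR_ge_taylor5 (R : realType) (x : R) : 0 <= x ->
  1 + x + x ^+ 2 / 2 + x ^+ 3 / 6 + x ^+ 4 / 24 + x ^+ 5 / 120 <= expR x.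
Proof.
pose p : {poly R} := 1 + 'X + 2^-1 *: 'X^2 + 6^-1 *: 'X^3 + 24^-1 *: 'X^4 +
  120^-1 *: 'X^5.
have pE y : p.[y] =
    1 + y + y ^+ 2 / 2 + y ^+ 3 / 6 + y ^+ 4 / 24 + y ^+ 5 / 120.
  by rewrite !hornerE /=; field.
have dpE y : (p^`()).[y] = p.[y] - y ^+ 5 / 120.
  by rewrite pE !poly.derivE !hornerE /=; field.
move=> /(@horner_le_expR _ p 1); rewrite !pE mul1r => le_p.
apply: le_trans (le_p _) _ => [y y_gt0|].
  by rewrite mul1r dpE lerBlDr lerDl divr_ge0 // exprn_ge0 // ltW.
by rewrite !expr0n /= !mul0r !addr0 mul1r.
Qed.

Lemma expRN_ge_taylor3 (R : realType) (x : R) : 0 <= x ->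
  1 - x + x ^+ 2 / 2 - x ^+ 3 / 6 <= expR (- x).
Proof.
pose p : {poly R} := 1 - 'X + 2^-1 *: 'X^2 - 6^-1 *: 'X^3.
have pE y : p.[y] = 1 - y + y ^+ 2 / 2 - y ^+ 3 / 6.
  by rewrite !hornerE /=; field.
have dpE y : (p^`()).[y] = - p.[y] - y ^+ 3 / 6.
  by rewrite pE !poly.derivE !hornerE /=; field.
move=> /(@horner_le_expR _ p (-1)); rewrite !pE mulN1r => le_p.
apply: le_trans (le_p _) _ => [y y_gt0|].
  by rewrite mulN1r dpE lerBlDr lerDl divr_ge0 // exprn_ge0 // ltW.
by rewrite !expr0n /= !mul0r oppr0 !addr0 mul1r.
Qed.

Lemma expR_ge_taylor3 (R : realType) (x : R) :
  1 + x + x ^+ 2 / 2 + x ^+ 3 / 6 <= expR x.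
Proof.
have [x_ge0|x_lt0] := leP 0 x.
  have := expR_ge_taylor5 x_ge0; have := exprn_ge0 4 x_ge0.
  by have := exprn_ge0 5 x_ge0; lra.
have /expRN_ge_taylor3 : 0 <= - x by lra.
by rewrite opprK; lra.
Qed.

(* The (2,2) Pade approximant bounds [expR] from below. *)
Lemma expR_ge_pade (R : realType) (x : R) : 0 <= x ->
  1 + x / 2 + x ^+ 2 / 12 <= (1 - x / 2 + x ^+ 2 / 12) * expR x.
Proof.
move=> x_ge0; have d_gt0 : 0 < 1 - x / 2 + x ^+ 2 / 12 by have := sqr_ge0 (x - 3); lra.
have := expR_ge_taylor5 x_ge0; rewrite -(ler_pM2l d_gt0); apply: le_trans.
rewrite -subr_ge0.
have -> : (1 - x / 2 + x ^+ 2 / 12) *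
    (1 + x + x ^+ 2 / 2 + x ^+ 3 / 6 + x ^+ 4 / 24 + x ^+ 5 / 120) -
    (1 + x / 2 + x ^+ 2 / 12) = x ^+ 5 * ((2 - x + x ^+ 2) / 1440) by field.
by rewrite mulr_ge0 ?exprn_ge0 //; have := sqr_ge0 (x - 1); have := sqr_ge0 x; lra.
Qed.

Lemma expRN_ge_pade1 (R : realType) (x : R) : 0 <= x ->
  1 - x / 2 <= (1 + x / 2) * expR (- x).
Proof.
pose f y : R := 1 - y / 2 - (1 + y / 2) * expR (- y).
pose df y : R := ((1 + y) * expR (- y) - 1) / 2.
have Df (y : R) : is_derive y (1 : R) f (df y).
  by rewrite /f; apply: is_derive_eq; rewrite /df /GRing.scale /=; field.
have f0 : f 0 = 0 by rewrite /f oppr0 expR0; ring.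
move=> x_ge0; suff : f x <= f 0 by rewrite f0 subr_le0.
apply: nincr_from_0 (x_ge0) => // y _.
rewrite /df pmulr_lle0 ?invr_gt0 // subr_le0 expRN ler_pdivrMr ?expR_gt0 //.
by rewrite mul1r expR_ge1Dx.
Qed.

(** The tilted mean of [z * (expR z - 1)] can be computed exactly, so all moments are compared with
    it. Here the terms after [z ^+ 2] are [9/2] times the cubic and quartic part of the tail
    polynomial. *)
Lemma quartic_le_mul_expm1 (R : realType) (z : R) : - (7 / 4) <= z ->
  z ^+ 2 + z ^+ 3 / 2 + z ^+ 4 / 9 <= z * (expR z - 1).
Proof.
have [z_ge0 _|z_lt0 z_ge] := leP 0 z.
  have -> : z ^+ 2 + z ^+ 3 / 2 + z ^+ 4 / 9 =
    z * (z + z ^+ 2 / 2 + z ^+ 3 / 9) by ring.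
  rewrite ler_wpM2l //; have := expR_ge_taylor3 z.
  by have := exprn_ge0 3 z_ge0; lra.
pose h := - z; have zE : z = - h by rewrite opprK.
have h_gt0 : 0 < h by rewrite oppr_gt0.
have h_le : h <= 7 / 4 by rewrite /h; lra.
move: z_lt0 z_ge => _ _; rewrite zE; move: (h) h_gt0 h_le => {zE} {z h} z z_gt0 z_le.
have -> : (- z) ^+ 2 + (- z) ^+ 3 / 2 + (- z) ^+ 4 / 9 =
    z * (z - z ^+ 2 / 2 + z ^+ 3 / 9) by ring.
rewrite mulNr -mulrN opprB ler_wpM2l ?(ltW z_gt0) //.
suff : expR (- z) <= 1 - z + z ^+ 2 / 2 - z ^+ 3 / 9 by lra.
rewrite expRN -div1r ler_pdivrMr ?expR_gt0 //.
have p_gt0 : 0 < 1 - z + z ^+ 2 / 2 - z ^+ 3 / 9.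
  have -> : 1 - z + z ^+ 2 / 2 - z ^+ 3 / 9 =
    (1 - z + z ^+ 2 / 4) + z ^+ 2 * ((9 / 4 - z) / 9) by field.
  have -> : 1 - z + z ^+ 2 / 4 = (1 - z / 2) ^+ 2 by field.
  by rewrite ltr_wpDl ?sqr_ge0 // mulr_gt0 ?exprn_gt0 //; lra.
have := expR_ge_taylor5 (ltW z_gt0); rewrite -(ler_pM2l p_gt0).
apply: le_trans; rewrite -subr_ge0.
set A := (X in 0 <= X).
have -> : A = z ^+ 3 * ((24 + 6 * z - 6 * z ^+ 2 + z ^+ 3 - 2 * z ^+ 4) / 432)
   + (1 - z + z ^+ 2 / 2 - z ^+ 3 / 9) * (z ^+ 5 / 120).
  by rewrite /A; field.
rewrite addr_ge0 //; last first.
  by rewrite mulr_ge0 ?(ltW p_gt0) // divr_ge0 ?exprn_ge0 // ltW.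
rewrite mulr_ge0 ?exprn_ge0 // ?(ltW z_gt0) // divr_ge0 //.
have d_ge0 : 0 <= 7 / 4 - z by rewrite subr_ge0.
have := mulr_ge0 (ltW z_gt0) d_ge0.
have := mulr_ge0 (exprn_ge0 2 (ltW z_gt0)) d_ge0.
by have := mulr_ge0 (exprn_ge0 3 (ltW z_gt0)) d_ge0; lra.
Qed.

(** A weaker comparison that remains available below [- (7/4)]. The bound [- (9/2)] is the negative
    zero of the left-hand side, which is nonpositive from there up to 0. *)
Lemma cubic_quartic_le_mul_expm1 (R : realType) (z : R) : - (9 / 2) <= z ->
  z ^+ 3 / 9 + 2 * z ^+ 4 / 81 <= z * (expR z - 1) / 9.
Proof.
have [z_ge0 _|z_lt0 z_ge] := leP 0 z.
  have -> : z ^+ 3 / 9 + 2 * z ^+ 4 / 81 =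
    z * ((z ^+ 2 + 2 * z ^+ 3 / 9) / 9) by field.
  rewrite -[leRHS]mulrA ler_wpM2l // ler_pM2r ?invr_gt0 //.
  have := expR_ge_taylor5 z_ge0; have := exprn_ge0 5 z_ge0.
  suff : 0 <= z * (1 - z / 2 - z ^+ 2 / 18 + z ^+ 3 / 24) by lra.
  rewrite mulr_ge0 //.
  have -> : 1 - z / 2 - z ^+ 2 / 18 + z ^+ 3 / 24 =
    (z / 24 + 11 / 72) * (z - 5 / 2) ^+ 2 + (z + 13) / 288 by field.
  by apply: addr_ge0; [apply: mulr_ge0; rewrite ?sqr_ge0 //; lra|lra].
have -> : z ^+ 3 / 9 + 2 * z ^+ 4 / 81 =
  - (z ^+ 2 * - z * ((9 / 2 + z) * 2 / 81)) by field.
apply: (@le_trans _ _ 0).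
  have z2_ge0 := sqr_ge0 z.
  rewrite oppr_le0; apply: mulr_ge0; last lra.
  by rewrite mulr_ge0 // oppr_ge0 ltW.
rewrite mulr_ge0 ?invr_ge0 // -mulrNN opprB mulr_ge0 ?oppr_ge0 ?(ltW z_lt0) //.
by rewrite subr_ge0 expR_le1 ltW.
Qed.

(** For [z = - h] the ratio of the two functions is [h / (1 - expR (- h))], which the Pade bound
    keeps below [1 + h / 2 + h ^+ 2 / 12]. *)
Lemma sqr_le_mul_expm1 (R : realType) (t z : R) : 0 <= t -> - t <= z ->
  z ^+ 2 <= (1 + t / 2 + t ^+ 2 / 12) * (z * (expR z - 1)).
Proof.
move=> t_ge0 z_ge.
have le_w (h : R) : 0 <= h -> h <= t ->
    1 + h / 2 + h ^+ 2 / 12 <= 1 + t / 2 + t ^+ 2 / 12.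
  by move=> h_ge0 h_le; have := lerXn2r 2 h_ge0 t_ge0 h_le; lra.
have z1_ge0 : 0 <= z * (expR z - 1).
  have [z_ge0|z_lt0] := leP 0 z.
    by rewrite mulr_ge0 // subr_ge0 -expR0 ler_expR.
  by rewrite -mulrNN mulr_ge0 ?oppr_ge0 ?subr_le0 ?expR_le1 // ltW.
have [z_ge0|z_lt0] := leP 0 z.
  apply: (@le_trans _ _ (z * (expR z - 1))).
    by rewrite expr2 ler_wpM2l // lerBrDl expR_ge1Dx.
  by rewrite ler_peMl //; have := le_w 0 (lexx _) t_ge0; lra.
pose h := - z; have h_gt0 : 0 < h by rewrite oppr_gt0.
have h_le : h <= t by rewrite lerNl.
apply: le_trans (ler_wpM2r z1_ge0 (le_w h (ltW h_gt0) h_le)).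
have zE : z = - h by rewrite opprK.
have le_E : (1 + h / 2 + h ^+ 2 / 12) * expR (- h) <= 1 - h / 2 + h ^+ 2 / 12.
  by rewrite expRN ler_pdivrMr ?expR_gt0 // expR_ge_pade // ltW.
rewrite zE; set E := expR (- h) in le_E *.
have -> : (1 + h / 2 + h ^+ 2 / 12) * (- h * (E - 1)) =
  h * ((1 + h / 2 + h ^+ 2 / 12) * (1 - E)) by ring.
by rewrite sqrrN expr2 ler_wpM2l ?(ltW h_gt0) //; lra.
Qed.

(** For [z >= 0], with [z] in place of [t], this is the Pade bound rearranged. It serves to bound
    the normalisation, where [z = t - t * X v] never exceeds [t]. *)
Lemma mul_expm1_le (R : realType) (t z : R) : 0 <= t -> z <= t ->
  (1 / 2 - t / 12) * (z * (expR z - 1)) <= expR z - 1 - z.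
Proof.
move=> t_ge0 z_le.
have z1_ge0 : 0 <= z * (expR z - 1).
  have [z_ge0|z_lt0] := leP 0 z.
    by rewrite mulr_ge0 // subr_ge0 -expR0 ler_expR.
  by rewrite -mulrNN mulr_ge0 ?oppr_ge0 ?subr_le0 ?expR_le1 // ltW.
have [z_ge0|z_lt0] := leP 0 z.
  apply: (@le_trans _ _ ((1 / 2 - z / 12) * (z * (expR z - 1)))).
    by rewrite ler_wpM2r //; lra.
  by have := expR_ge_pade z_ge0; lra.
apply: (@le_trans _ _ ((1 / 2) * (z * (expR z - 1)))).
  by rewrite ler_wpM2r //; lra.
have /expRN_ge_pade1 : 0 <= - z by rewrite oppr_ge0 ltW.
by rewrite opprK; lra.
Qed.

(* A quartic below [exp(-w)] that is nonpositive for [w <= -3]. *)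
Definition tail_quartic (R : realType) (w : R) : R :=
  1 - w + w ^+ 2 / 9 + w ^+ 3 / 9 - 2 * w ^+ 4 / 81.

(** The factors show the design: a sign change at the threshold [-3], value 1 and slope [-1] at 0 as
    for [expR (- w)], and no positive values beyond [3/2], thanks to the double zero at 3. *)
Lemma tail_quarticE (R : realType) (w : R) :
  tail_quartic w = (1 - w / 3) ^+ 2 * (1 + w / 3) * (1 - 2 * w / 3).
Proof. by rewrite /tail_quartic; field. Qed.

Lemma expR_mul_tail_quartic_le (R : realType) (w : R) : expR w * tail_quartic w <= (- 3 < w)%R%:R.
Proof.
have [w_gt|w_le] := ltP (-3) w; last first.
  rewrite tail_quarticE pmulr_rle0 ?expR_gt0 // -mulrA mulr_ge0_le0 ?sqr_ge0 //.
  by rewrite mulr_le0_ge0 //; lra.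
have [w_le|w_ge] := leP w (3 / 2); last first.
  apply: (@le_trans _ _ 0) => //.
  rewrite tail_quarticE pmulr_rle0 ?expR_gt0 // -mulrA mulr_ge0_le0 ?sqr_ge0 //.
  by rewrite mulr_ge0_le0 //; lra.
rewrite mulrC -ler_pdivlMr ?expR_gt0 // div1r -expRN.
apply: le_trans (expR_ge_taylor3 (- w)).
suff : 0 <= w ^+ 2 * (2 * w ^+ 2 / 81 - 5 * w / 18 + 7 / 18).
  by rewrite /tail_quartic; lra.
by rewrite mulr_ge0 ?sqr_ge0 //; have := sqr_ge0 (w - 3 / 2); lra.
Qed.

(** * The scalar inequality behind the constant 7/50 *)

(** [3/14] is [3/2] times [1/7], the largest [1/m] considered; [17/15 * (3/2) = 17/10] is the
    coefficient of [s] in the bounds that follow. *)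
Lemma expR_le_affine (R : realType) (x : R) : 0 <= x <= 3 / 14 ->
  expR x <= 1 + 17 / 15 * x.
Proof.
move=> /andP[x_ge0 x_le].
have p_ge0 : 0 <= 1 + 17 / 15 * x by lra.
rewrite -(ler_pM2r (expR_gt0 (- x))) -expRD subrr expR0.
apply: le_trans (ler_wpM2l p_ge0 (expRN_ge_taylor3 x_ge0)).
have d_ge0 : 0 <= 3 / 14 - x by lra.
have := mulr_ge0 x_ge0 (sqr_ge0 (x - 3 / 14)); have := exprn_ge0 3 x_ge0.
have := mulr_ge0 (exprn_ge0 3 x_ge0) d_ge0.
by have := mulr_ge0 x_ge0 d_ge0; lra.
Qed.

(** The fourth and sixth powers of this bound give the estimates of [expR 1] and [expR (3 / 2)]. *)
Lemma expRN_1_4_ge (R : realType) : 7786 / 10000 <= expR (- (1 / 4)) :> R.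
Proof.
have /expRN_ge_taylor3 : 0 <= 1 / 4 :> R by lra.
lra.
Qed.

Lemma expR_3_2_le (R : realType) : expR (3 / 2) <= 9 / 2 :> R.
Proof.
have E_gt0 : 0 < 9 / 2 :> R by lra.
rewrite -(ler_pM2r (expR_gt0 (- (3 / 2)))) -expRD subrr expR0.
have -> : - (3 / 2) = - (1 / 4) * 6 :> R by field.
have q_ge0 : 0 <= 7786 / 10000 :> R by lra.
rewrite expRM_natr.
by have := lerXn2r 6 q_ge0 (expR_ge0 _) (expRN_1_4_ge R); lra.
Qed.

Lemma concave_quadratic_ge (R : realFieldType) (c y x1 x2 x : R) :
  0 <= c -> x1 <= x <= x2 -> y <= x1 / 3 - c * x1 ^+ 2 ->
  y <= x2 / 3 - c * x2 ^+ 2 -> y <= x / 3 - c * x ^+ 2.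
Proof.
move=> c_ge0 /andP[le1 le2] y1 y2.
have [d_gt0|d_le0] := ltP 0 (x2 - x1); last first.
  by have -> : x = x1 by lra.
have h0 : 0 <= c * ((x - x1) * (x2 - x)) by rewrite !mulr_ge0 // subr_ge0.
have h1 : 0 <= (x1 / 3 - c * x1 ^+ 2 - y) * (x2 - x).
  by rewrite mulr_ge0 // subr_ge0.
have h2 : 0 <= (x2 / 3 - c * x2 ^+ 2 - y) * (x - x1).
  by rewrite mulr_ge0 // subr_ge0.
have h3 : 0 <= c * ((x - x1) * (x2 - x)) * (x2 - x1).
  by rewrite mulr_ge0 // ltW.
rewrite -subr_ge0 -(pmulr_rge0 _ d_gt0); lra.
Qed.

(** The right-hand side is affine and nonincreasing in [s], with slope [- F1]. Near [t = 0] the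
    margin is too thin for [s <= 1/7], so the relation [a * s <= t] is used, after multiplying by
    [a]. *)
Lemma small_tilt_endpoint (R : realFieldType) (t s a : R) :
  0 <= t <= 38 / 100 -> 0 <= s -> a = 3 - 98 / 100 * t -> a * s <= t ->
  63 / 100 - 1379 / 10000 * t <=
  1 - 2 / 9 * (a * (1 + 17 / 10 * s)) +
  ((301 / 100 + 424 / 1000 * t) * (1 + 17 / 10 * s)) / 3 -
  2 / 27 * (1 + 24 / 10 * s) * (301 / 100 + 424 / 1000 * t) ^+ 2.
Proof.
move=> /andP[t_ge0 t_le] s_ge0 aE as_le.
have a_gt0 : 0 < a by lra.
have d_ge0 : 0 <= 38 / 100 - t by lra.
pose F1 : R := 2 / 9 * a * (17 / 10)
  - (301 / 100 + 424 / 1000 * t) * (17 / 10) / 3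
  + 2 / 27 * (24 / 10) * (301 / 100 + 424 / 1000 * t) ^+ 2.
have F1_ge0 : 0 <= F1.
  by rewrite /F1 aE; have := mulr_ge0 t_ge0 d_ge0; have := sqr_ge0 t; lra.
pose F0 : R := 1 - 2 / 9 * a + (301 / 100 + 424 / 1000 * t) / 3 -
  2 / 27 * (301 / 100 + 424 / 1000 * t) ^+ 2 - (63 / 100 - 1379 / 10000 * t).
have F_ge0 : 0 <= a * F0 - t * F1.
  rewrite /F0 /F1 aE; have := mulr_ge0 t_ge0 d_ge0.
  have := mulr_ge0 (exprn_ge0 2 t_ge0) d_ge0; have := exprn_ge0 3 t_ge0; lra.
have : 0 <= a * (F0 - s * F1).
  by have := ler_wpM2r F1_ge0 as_le; lra.
by rewrite pmulr_rge0 // /F0 /F1; lra.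
Qed.

(** Away from [t = 0] the worst case [s = 1/7] is affordable. *)
Lemma mid_tilt_endpoint (R : realFieldType) (t s a : R) :
  38 / 100 <= t <= 7 / 4 -> 0 <= s <= 1 / 7 -> a = 3 - 98 / 100 * t ->
  615 / 1000 - 977 / 10000 * t <=
  1 - 2 / 9 * (a * (1 + 17 / 10 * s)) +
  ((306 / 100 + 28 / 100 * t) * (1 + 17 / 10 * s)) / 3 -
  2 / 27 * (1 + 24 / 10 * s) * (306 / 100 + 28 / 100 * t) ^+ 2.
Proof.
move=> /andP[t_ge t_le] /andP[s_ge0 s_le] aE.
pose F1 : R := 2 / 9 * a * (17 / 10)
  - (306 / 100 + 28 / 100 * t) * (17 / 10) / 3
  + 2 / 27 * (24 / 10) * (306 / 100 + 28 / 100 * t) ^+ 2.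
have t2 : 0 <= (7 / 4 - t) * (t - 38 / 100) by rewrite mulr_ge0 // subr_ge0.
have F1_ge0 : 0 <= F1 by rewrite /F1 aE; have := sqr_ge0 t; lra.
by have := ler_wpM2r F1_ge0 s_le; rewrite /F1 aE; lra.
Qed.

Lemma expR1_le (R : realType) : expR 1 <= 275 / 100 :> R.
Proof.
have E_ge0 : 0 <= 275 / 100 :> R by lra.
rewrite -(ler_pM2r (expR_gt0 (- 1))) -expRD subrr expR0.
have -> : - 1 = - (1 / 4) * 4 :> R by field.
have q_ge0 : 0 <= 7786 / 10000 :> R by lra.
rewrite expRM_natr.
by have := lerXn2r 4 q_ge0 (expR_ge0 _) (expRN_1_4_ge R); lra.
Qed.

(** For [K <= 3/2] the two terms in [K] have a nonnegative sum, so [L <= b / 9] is enough. The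
    number [63/100] is [7/50] times the bound [9/2] on [expR (3 / 2)]. *)
Lemma tilt_small_K (R : realFieldType) (s t b K L T : R) :
  0 <= s -> 0 <= t <= 31 / 10 -> T * (1 + 24 / 100 * t) <= 63 / 100 ->
  b <= 3 + 72 / 100 * t -> 0 <= K <= 7 / 5 -> L <= b / 9 ->
  T <= 1 + K / 9 - L - 2 / 27 * (1 - s) * K ^+ 2.
Proof.
move=> s_ge0 /andP[t_ge0 t_le] T_le b_le /andP[K_ge0 K_le] L_le.
have q_gt0 : 0 < 1 + 24 / 100 * t by lra.
apply: (@le_trans _ _ (1 - b / 9)); last first.
  have KK : 0 <= K * (7 / 5 - K) by rewrite mulr_ge0 // subr_ge0.
  by have := mulr_ge0 s_ge0 (sqr_ge0 K); clear -L_le KK K_ge0; lra.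
rewrite -(ler_pM2r q_gt0); apply: le_trans T_le _.
apply: (@le_trans _ _ ((2 / 3 - 8 / 100 * t) * (1 + 24 / 100 * t))).
  have : 0 <= t * (31 / 10 - t) by rewrite mulr_ge0 // subr_ge0.
  by clear -t_ge0; lra.
by rewrite ler_wpM2r ?(ltW q_gt0) //; clear -b_le; lra.
Qed.

(** For [t] above [7/4] the sharper bound on [L] is not at hand, but [a] is then small enough for
    [L <= b / 9]. The number [385/1000] is [7/50] times the bound on [expR 1]. *)
Lemma tilt_large_t (R : realFieldType) (s t a b K L T : R) :
  0 <= s -> 7 / 4 <= t <= 31 / 10 -> a = 3 - 98 / 100 * t ->
  T <= 385 / 1000 -> b <= 117 / 100 * a ->
  0 <= K -> K <= (1 + t / 2 + t ^+ 2 / 12) * b -> L <= b / 9 ->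
  T <= 1 + K / 9 - L - 2 / 27 * (1 - s) * K ^+ 2.
Proof.
move=> s_ge0 /andP[t_ge t_le] aE T_le b_le K_ge0 K_le L_le.
have t_ge0 : 0 <= t by lra.
have wa : (1 + t / 2 + t ^+ 2 / 12) * a <= 274 / 100.
  have h1 : 0 <= (t - 7 / 4) * t by rewrite mulr_ge0 // subr_ge0.
  have h2 : 0 <= (t - 7 / 4) * t ^+ 2 by rewrite mulr_ge0 ?exprn_ge0 // subr_ge0.
  by rewrite aE; clear -h1 h2 t_ge; lra.
have w_ge0 : 0 <= 1 + t / 2 + t ^+ 2 / 12.
  by have := sqr_ge0 t; clear -t_ge0; lra.
have K_le3 : K <= 321 / 100.
  by have := ler_wpM2l w_ge0 b_le; clear -K_le wa; lra.
have b_le2 : b <= 151 / 100 by clear -b_le aE t_ge; lra.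
have : 0 <= K * (321 / 100 - K) by rewrite mulr_ge0 // subr_ge0.
by have := mulr_ge0 s_ge0 (sqr_ge0 K); clear -K_ge0 K_le3 b_le2 L_le T_le; lra.
Qed.

(* For fixed [b] the bound is concave in [K], so only the two ends of the
   range of [K] matter. *)
Lemma tilt_small_t (R : realFieldType) (s t a b K L T : R) :
  0 <= s <= 1 / 7 -> 0 <= t <= 7 / 4 -> a = 3 - 98 / 100 * t -> a * s <= t ->
  T * (1 + 24 / 100 * t) <= 63 / 100 -> b <= a * (1 + 17 / 10 * s) ->
  7 / 5 <= K -> K <= (1 + t / 2 + t ^+ 2 / 12) * b -> L <= 2 / 9 * (b - K) ->
  T <= 1 + K / 9 - L - 2 / 27 * (1 - s) * K ^+ 2.
Proof.
move=> s_in t_in aE as_le T_le b_le K_ge K_le L_le.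
have /andP[s_ge0 s_le] := s_in; have /andP[t_ge0 t_le] := t_in.
have a_ge0 : 0 <= a by rewrite aE; clear -t_le; lra.
have q_gt0 : 0 < 1 + 24 / 100 * t by clear -t_ge0; lra.
have s1_ge0 : 0 <= 1 + 17 / 10 * s by clear -s_ge0; lra.
pose c := 2 / 27 * (1 - s); pose bb := a * (1 + 17 / 10 * s).
have c_ge0 : 0 <= c by rewrite /c mulr_ge0 //; clear -s_le; lra.
suff : T - 1 + 2 / 9 * bb <= K / 3 - c * K ^+ 2.
  by rewrite -/bb in b_le; rewrite -/c; clear -b_le L_le; lra.
(* [P] is the product of [1 + t / 2 + t ^+ 2 / 12] and [a] without its negative cubic term; below it
   is replaced by a line [Q], chosen separately for small and moderate [t]. *)
pose P := 3 + 52 / 100 * t - 24 / 100 * t ^+ 2.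
have wP : (1 + t / 2 + t ^+ 2 / 12) * a <= P.
  by rewrite aE /P; have := exprn_ge0 3 t_ge0; have := sqr_ge0 t; clear -t_ge0; lra.
have w_ge0 : 0 <= 1 + t / 2 + t ^+ 2 / 12.
  by have := sqr_ge0 t; clear -t_ge0; lra.
have K_le3 : K <= P * (1 + 17 / 10 * s).
  apply: le_trans K_le _; apply: le_trans (ler_wpM2r s1_ge0 wP).
  by rewrite -[leRHS]mulrA ler_wpM2l.
(* The coefficient [24/10] comes from [(1 - s) (1 + 17/10 s)^2 <= 1 + 24/10 s], which makes the
   bound affine in [s]. *)
have upper_end Q T' : T <= T' ->
    T' <= 1 - 2 / 9 * (a * (1 + 17 / 10 * s)) + (Q * (1 + 17 / 10 * s)) / 3 -
      2 / 27 * (1 + 24 / 10 * s) * Q ^+ 2 ->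
    T - 1 + 2 / 9 * bb <= (Q * (1 + 17 / 10 * s)) / 3 -
      c * (Q * (1 + 17 / 10 * s)) ^+ 2.
  move=> le1 le2.
  have Q2 : (1 - s) * (1 + 17 / 10 * s) ^+ 2 * Q ^+ 2 <= (1 + 24 / 10 * s) * Q ^+ 2.
    rewrite ler_wpM2r ?sqr_ge0 //.
    by have := sqr_ge0 s; have := exprn_ge0 3 s_ge0; clear -s_ge0; lra.
  by rewrite /c /bb; clear -le1 le2 Q2; lra.
have lower_end : T - 1 + 2 / 9 * bb <= 7 / 5 / 3 - c * (7 / 5) ^+ 2.
  suff : T <= 1 - 2 / 9 * bb + 7 / 5 / 3 - 2 / 27 * (7 / 5) ^+ 2.
    by rewrite /c; clear -s_ge0; lra.
  rewrite -(ler_pM2r q_gt0); apply: le_trans T_le _.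
  have [t_le2|t_gt2] := leP t (1 / 2).
    apply: (@le_trans _ _ ((6548 / 10000 - 16 / 100 * t) * (1 + 24 / 100 * t))).
      have : 0 <= t * (1 / 2 - t) by rewrite mulr_ge0 // subr_ge0.
      by clear -t_ge0 t_le2; lra.
    by rewrite ler_wpM2r ?(ltW q_gt0) // /bb; clear -as_le aE; lra.
  have as_le2 : a * s <= a * (1 / 7) by rewrite ler_wpM2l.
  apply: (@le_trans _ _ ((492 / 1000 + 27 / 100 * t) * (1 + 24 / 100 * t))).
    by have := sqr_ge0 t; clear -t_gt2; lra.
  by rewrite ler_wpM2r ?(ltW q_gt0) // /bb; clear -as_le2 aE t_ge0; lra.
have [t_le2|t_gt2] := leP t (38 / 100).
  pose Q := 301 / 100 + 424 / 1000 * t.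
  have PQ : P <= Q by rewrite /P /Q; have := sqr_ge0 (t - 1 / 5); clear; lra.
  apply: (@concave_quadratic_ge _ c _ (7 / 5) (Q * (1 + 17 / 10 * s))) => //.
    by rewrite K_ge (le_trans K_le3) // ler_wpM2r.
  apply: (upper_end _ (63 / 100 - 1379 / 10000 * t)).
    rewrite -(ler_pM2r q_gt0); apply: le_trans T_le _.
    have : 0 <= t * (38 / 100 - t) by rewrite mulr_ge0 // subr_ge0.
    by clear -t_ge0; lra.
  by apply: small_tilt_endpoint; rewrite ?t_ge0.
pose Q := 306 / 100 + 28 / 100 * t.
have PQ : P <= Q by rewrite /P /Q; have := sqr_ge0 (t - 1 / 2); clear; lra.
apply: (@concave_quadratic_ge _ c _ (7 / 5) (Q * (1 + 17 / 10 * s))) => //.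
  by rewrite K_ge (le_trans K_le3) // ler_wpM2r.
apply: (upper_end _ (615 / 1000 - 977 / 10000 * t)).
  rewrite -(ler_pM2r q_gt0); apply: le_trans T_le _.
  have : 0 <= (t - 38 / 100) * (7 / 4 - t) by rewrite mulr_ge0 // subr_ge0 // ltW.
  by clear -t_le; lra.
by apply: mid_tilt_endpoint; rewrite ?t_le ?(ltW t_gt2).
Qed.

(* In [feige_large], with [mu] the tilted mean of [t X] and [zeta] its centred
   version: [s = 1/m], [a = m (t - mu)], [K = m E zeta^2],
   [L = m E (zeta^3/9 + 2 zeta^4/81)], and [Y = B^m] is the normalisation. *)
Lemma tilt_inequality (R : realType) (s t a b K L Y B : R) :
  0 <= s <= 1 / 7 -> 0 <= t -> a = 3 - 98 / 100 * t -> 0 <= a -> a * s <= t ->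
  0 <= B -> b = a * B ->
  B <= expR (a * (1 / 2 + t / 12) * s) -> Y <= expR (a * (1 / 2 + t / 12)) ->
  0 <= K -> K <= (1 + t / 2 + t ^+ 2 / 12) * b ->
  L <= b / 9 -> (t <= 7 / 4 -> L <= 2 / 9 * (b - K)) ->
  7 / 50 * Y <= 1 + K / 9 - L - 2 / 27 * (1 - s) * K ^+ 2.
Proof.
move=> s_in t_ge0 aE a_ge0 as_le B_ge0 bE B_le Y_le K_ge0 K_le L_le L_le2.
have /andP[s_ge0 s_le] := s_in.
have t_le : t <= 31 / 10 by clear -aE a_ge0; lra.
set e := a * (1 / 2 + t / 12) in B_le Y_le.
have t2_ge0 := sqr_ge0 t.
have e_ge0 : 0 <= e by rewrite /e mulr_ge0 //; clear -t_ge0; lra.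
have e_le : e <= 3 / 2 - 24 / 100 * t by rewrite /e aE; clear -t2_ge0; lra.
have es_ge0 : 0 <= e * s by rewrite mulr_ge0.
have es_le : e * s <= 3 / 2 * s by rewrite ler_wpM2r //; clear -e_le t_ge0; lra.
have b_le1 : b <= a * (1 + 17 / 10 * s).
  rewrite bE ler_wpM2l //; apply: le_trans B_le _.
  by apply: le_trans (expR_le_affine _) _; clear -es_ge0 es_le s_le; lra.
(* The gain [24/100 * t] in the exponent becomes a polynomial factor through [1 + x <= expR x],
   leaving only the constant [expR (3 / 2)]. *)
have T_le : 7 / 50 * Y * (1 + 24 / 100 * t) <= 63 / 100.
  have q_ge0 : 0 <= 1 + 24 / 100 * t by clear -t_ge0; lra.
  have Y_le2 : Y <= expR (3 / 2 - 24 / 100 * t).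
    by apply: le_trans Y_le _; rewrite ler_expR.
  have : Y * (1 + 24 / 100 * t) <= expR (3 / 2).
    apply: le_trans (ler_wpM2r q_ge0 Y_le2) _.
    apply: le_trans (ler_wpM2l (expR_ge0 _) (expR_ge1Dx _)) _.
    by rewrite -expRD subrK.
  by have := expR_3_2_le R; clear; lra.
have [K_small|K_large] := leP K (7 / 5).
  apply: tilt_small_K T_le _ _ L_le; rewrite ?t_ge0 ?K_ge0 //.
  by clear -b_le1 as_le aE; lra.
have [t_small|t_large] := leP t (7 / 4).
  by apply: tilt_small_t aE as_le T_le b_le1 (ltW K_large) K_le (L_le2 t_small); rewrite ?t_ge0.
have e_le1 : e <= 1.
  by rewrite /e aE; have := sqr_ge0 (t - 7 / 4); clear -t_large; lra.
have es_le1 : e * s <= 1 / 7 by have := ler_pM e_ge0 s_ge0 e_le1 s_le; clear; lra.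
apply: tilt_large_t aE _ _ K_ge0 K_le L_le => //; first by rewrite (ltW t_large).
  have : Y <= expR 1 by apply: le_trans Y_le _; rewrite ler_expR.
  by have := expR1_le R; clear; lra.
rewrite bE mulrC ler_wpM2r //; apply: le_trans B_le _.
by apply: le_trans (expR_le_affine _) _; clear -es_ge0 es_le1; lra.
Qed.

(** * Sums of independent identically distributed variables *)

Definition fcons (T : finType) (m : nat) (v : T) (g : {ffun 'I_m -> T}) :
    {ffun 'I_m.+1 -> T} :=
  [ffun i => if unlift ord0 i is Some j then g j else v].

Lemma fcons0 (T : finType) (m : nat) (v : T) (g : {ffun 'I_m -> T}) :
  fcons v g ord0 = v.
Proof. by rewrite ffunE unlift_none. Qed.

Lemma fconsS (T : finType) (m : nat) (v : T) (g : {ffun 'I_m -> T}) (j : 'I_m) :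
  fcons v g (lift ord0 j) = g j.
Proof. by rewrite ffunE liftK. Qed.

Lemma big_ffun_recl (R : Type) (idx : R) (op : Monoid.com_law idx)
    (T : finType) (m : nat) (F : {ffun 'I_m.+1 -> T} -> R) :
  \big[op/idx]_f F f = \big[op/idx]_v \big[op/idx]_g F (fcons v g).
Proof.
rewrite pair_big (reindex (fun p => fcons p.1 p.2)) //=.
exists (fun f : {ffun 'I_m.+1 -> T} => (f ord0, [ffun j => f (lift ord0 j)])).
  move=> [v g] _ /=; rewrite fcons0; congr (_, _).
  by apply/ffunP => j; rewrite ffunE fconsS.
move=> f _; apply/ffunP => i /=; rewrite ffunE.
by case: unliftP => [j ->|->] //; rewrite ffunE.
Qed.

(* The expectation of [F (z (f 0) + ... + z (f (m - 1)))] when the entries of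
   [f] are independent with law [q]. *)
Definition iid_mean (R : comNzRingType) (T : finType) (q z : T -> R) (m : nat)
    (F : R -> R) : R :=
  \sum_(f : {ffun 'I_m -> T}) (\prod_i q (f i)) * F (\sum_i z (f i)).

Lemma iid_meanS (R : comNzRingType) (T : finType) (q z : T -> R) m (F : R -> R) :
  iid_mean q z m.+1 F = \sum_v q v * iid_mean q z m (fun s => F (z v + s)).
Proof.
rewrite /iid_mean big_ffun_recl; apply: eq_bigr => v _.
rewrite big_distrr /=; apply: eq_bigr => g _.
rewrite !big_ord_recl fcons0 mulrA; congr (_ * _ * F (_ + _)).
  by apply: eq_bigr => j _; rewrite fconsS.
by apply: eq_bigr => j _; rewrite fconsS.
Qed.

(** Fixing one entry shifts the polynomial, so the induction runs over all quartics at once; the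
    linear coefficient drops out because [z] has mean 0. *)
Lemma iid_mean_quartic (R : comNzRingType) (T : finType) (q z : T -> R) m
    (c0 c1 c2 c3 c4 : R) :
  \sum_v q v = 1 -> \sum_v q v * z v = 0 ->
  iid_mean q z m (fun s => c0 + c1 * s + c2 * s ^+ 2 + c3 * s ^+ 3 + c4 * s ^+ 4) =
  c0 + c2 * (m%:R * \sum_v q v * z v ^+ 2) + c3 * (m%:R * \sum_v q v * z v ^+ 3) +
  c4 * (m%:R * \sum_v q v * z v ^+ 4 +
        3 * m%:R * (m%:R - 1) * (\sum_v q v * z v ^+ 2) ^+ 2).
Proof.
move=> q1 z0; set S2 := \sum_v q v * z v ^+ 2; set S3 := \sum_v q v * z v ^+ 3.
set S4 := \sum_v q v * z v ^+ 4.
elim: m c0 c1 c2 c3 c4 => [|m IH] c0 c1 c2 c3 c4.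
  rewrite /iid_mean (eq_bigr (fun=> c0)).
    by rewrite sumr_const card_ffun card_ord expn0 mulr1n; ring.
  by move=> f _; rewrite !big_ord0; ring.
rewrite iid_meanS.
pose D0 := c0 + c2 * (m%:R * S2) + c3 * (m%:R * S3) +
  c4 * (m%:R * S4 + 3 * m%:R * (m%:R - 1) * S2 ^+ 2).
pose D1 := c1 + 3 * c3 * (m%:R * S2) + 4 * c4 * (m%:R * S3).
pose D2 := c2 + 6 * c4 * (m%:R * S2).
have E v : iid_mean q z m (fun s => c0 + c1 * (z v + s) + c2 * (z v + s) ^+ 2 +
    c3 * (z v + s) ^+ 3 + c4 * (z v + s) ^+ 4) =
    D0 + D1 * z v + D2 * z v ^+ 2 + c3 * z v ^+ 3 + c4 * z v ^+ 4.
  transitivity (iid_mean q z m (fun s =>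
    (c0 + c1 * z v + c2 * z v ^+ 2 + c3 * z v ^+ 3 + c4 * z v ^+ 4) +
    (c1 + 2 * c2 * z v + 3 * c3 * z v ^+ 2 + 4 * c4 * z v ^+ 3) * s +
    (c2 + 3 * c3 * z v + 6 * c4 * z v ^+ 2) * s ^+ 2 +
    (c3 + 4 * c4 * z v) * s ^+ 3 + c4 * s ^+ 4)).
    by apply: eq_bigr => f _; congr (_ * _); ring.
  by rewrite IH /D0 /D1 /D2; ring.
under eq_bigr do rewrite E.
transitivity (\sum_v (D0 * q v + D1 * (q v * z v) + D2 * (q v * z v ^+ 2) +
    c3 * (q v * z v ^+ 3) + c4 * (q v * z v ^+ 4))).
  by apply: eq_bigr => v _; ring.
rewrite !big_split /= -!big_distrr /= q1 z0 -/S2 -/S3 -/S4 /D0 /D2.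
by rewrite -[m.+1]addn1 natrD; ring.
Qed.

(** Chebyshev's sum inequality in pointwise form: summed over an [X] of mean 1, it shows that the
    tilt does not raise the mean. *)
Lemma sub1_mul_expR_le (R : realType) (t x : R) : 0 <= t ->
  (x - 1) * expR (- (t * x)) <= (x - 1) * expR (- t).
Proof.
move=> t_ge0; have [x_ge1|x_lt1] := leP 1 x.
  by rewrite ler_wpM2l ?subr_ge0 // ler_expR lerN2 ler_peMr.
by rewrite ler_wnM2l ?subr_le0 ?(ltW x_lt1) // ler_expR lerN2 ler_piMr // ltW.
Qed.

(* The threshold [m + th], scaled by [t], exceeds the tilted mean of the scaled
   sum by exactly 3. *)
Lemma exists_tilt (R : realType) (T : finType) (X : T -> R) (m : nat) (th : R) :
  0 < th -> (0 < #|T|)%N -> \sum_v X v = #|T|%:R ->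
  exists2 t, 0 < t &
    \sum_v expR (- (t * X v)) * (t * (m%:R + th) - m%:R * (t * X v) - 3) = 0.
Proof.
move=> th_gt0 T_gt0 EX.
pose H t := \sum_v expR (- (t * X v)) * (t * (m%:R + th) - m%:R * (t * X v) - 3).
have H0 : H 0 = - (3 * #|T|%:R).
  rewrite /H (eq_bigr (fun=> - 3)) ?sumr_const ?mulNrn ?mulr_natr //.
  by move=> v _; rewrite !mul0r oppr0 expR0; ring.
have t1_gt0 : 0 < 3 / th by rewrite divr_gt0.
(* For [t = 3 / th] the constant 3 cancels [t * th], and only the sign of the tilted mean of [X - 1]
   matters. *)
have Ht1 : 0 <= H (3 / th).
  set t := 3 / th in t1_gt0 *; rewrite /H.
  rewrite (eq_bigr (fun v => - (m%:R * t) * ((X v - 1) * expR (- (t * X v))))).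
    rewrite -big_distrr /= mulr_le0 //.
      by rewrite oppr_le0 mulr_ge0 // ltW.
    apply: (@le_trans _ _ (\sum_v (X v - 1) * expR (- t))).
      by apply: ler_sum => v _; apply: sub1_mul_expR_le; apply: ltW.
    by rewrite -big_distrl /= big_split /= EX sumrN sumr_const subrr mul0r.
  have tth : t * th = 3 by rewrite /t divfK // gt_eqF.
  by move=> v _; rewrite -[in LHS]tth; ring.
have cH : {within `[0, 3 / th], continuous H}%classic.
  apply: continuous_subspaceT => t; apply: cvg_big => [|v _]; first exact: add_continuous.
  apply: cvgM; last first.
    apply: cvgB; last exact: cvg_cst.
    apply: cvgB; first by apply: cvgM; [exact: cvg_id|exact: cvg_cst].
    apply: cvgM; first exact: cvg_cst.
    by apply: cvgM; [exact: cvg_id|exact: cvg_cst].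
  apply: continuous_comp; last exact: continuous_expR.
  by apply: cvgN; apply: cvgM; [apply: cvg_id|apply: cvg_cst].
have [|t t_in Ht] := @IVT R H 0 (3 / th) 0 (ltW t1_gt0) cH.
  rewrite ge_min le_max H0 oppr_le0 mulr_ge0 //= Ht1 orbT //.
exists t => //; rewrite lt_neqAle; move: t_in; rewrite in_itv /= => /andP[-> _].
rewrite andbT; apply: contra_eqN Ht => /eqP <-.
by rewrite H0 oppr_eq0 mulf_neq0 // pnatr_eq0 // -lt0n.
Qed.

Lemma feige_large (R : realType) (T : finType) (X : T -> R) (m : nat) :
  (6 < m)%N -> (0 < #|T|)%N -> (forall v, 0 <= X v) -> \sum_v X v = #|T|%:R ->
  7 / 50 * #|T|%:R ^+ m <=
  \sum_(f : {ffun 'I_m -> T}) (\sum_i X (f i) < m%:R + 98 / 100)%R%:R :> R.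
Proof.
move=> m_gt6 T_gt0 X_ge0 EX.
have th_gt0 : 0 < 98 / 100 :> R by lra.
have [t t_gt0 tilt] := exists_tilt m th_gt0 T_gt0 EX.
have N_gt0 : 0 < #|T|%:R :> R by rewrite ltr0n.
have m_gt0 : 0 < m%:R :> R by rewrite ltr0n (leq_trans _ m_gt6).
pose Z := \sum_v expR (- (t * X v)).
have /card_gt0P[v0 _] := T_gt0.
have Z_gt0 : 0 < Z.
  rewrite /Z (bigD1 v0) //= ltr_pwDl ?expR_gt0 // sumr_ge0 // => v _.
  exact: expR_ge0.
pose q v := expR (- (t * X v)) / Z.
have q_ge0 v : 0 <= q v by rewrite divr_ge0 ?expR_ge0 // ltW.
have q1 : \sum_v q v = 1 by rewrite -big_distrl /= divff // gt_eqF.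
have qc c : \sum_v q v * c = c by rewrite -[RHS]mul1r -q1 big_distrl.
pose mu := \sum_v q v * (t * X v).
pose zeta v := t * X v - mu.
have muE : t * (m%:R + 98 / 100) - m%:R * mu = 3.
  apply/eqP; rewrite -subr_eq0; apply/eqP.
  transitivity (Z^-1 * \sum_v expR (- (t * X v)) *
      (t * (m%:R + 98 / 100) - m%:R * (t * X v) - 3)); last by rewrite tilt mulr0.
  rewrite /mu !big_distrr /=.
  transitivity (\sum_v (q v * (t * (m%:R + 98 / 100)) - m%:R * (q v * (t * X v)) - q v * 3)).
    by rewrite !big_split /= !sumrN !qc -big_distrr.
  by apply: eq_bigr => v _; rewrite /q; field; rewrite gt_eqF.
have qz : \sum_v q v * zeta v = 0.
  rewrite (eq_bigr (fun v => q v * (t * X v) - q v * mu)); last first.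
    by move=> v _; rewrite mulrBr.
  by rewrite big_split /= sumrN qc subrr.
have mu_ge0 : 0 <= mu.
  by apply: sumr_ge0 => v _; rewrite mulr_ge0 ?q_ge0 // mulr_ge0 ?X_ge0 ?(ltW t_gt0).
have mu_le : mu <= t.
  rewrite -(qc t) -subr_le0 -sumrB.
  rewrite (eq_bigr (fun v => t / Z * ((X v - 1) * expR (- (t * X v))))); last first.
    by move=> v _; rewrite /q; field; rewrite gt_eqF.
  rewrite -big_distrr /= mulr_ge0_le0 ?divr_ge0 ?(ltW t_gt0) ?(ltW Z_gt0) //.
  apply: (@le_trans _ _ (\sum_v (X v - 1) * expR (- t))).
    by apply: ler_sum => v _; apply: sub1_mul_expR_le; apply: ltW.
  by rewrite -big_distrl /= big_split /= EX sumrN sumr_const subrr mul0r.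
pose a := m%:R * (t - mu).
have aE : a = 3 - 98 / 100 * t by rewrite /a; lra.
have a_ge0 : 0 <= a by rewrite mulr_ge0 ?subr_ge0 // ltW.
have as_le : a * m%:R^-1 <= t.
  by rewrite /a mulrAC mulfV ?gt_eqF // mul1r gerBl.
have t_le : t <= 31 / 10 by lra.
have zeta_ge v : - mu <= zeta v by rewrite /zeta -subr_ge0 addrK mulr_ge0 // ltW.
pose L := expR mu * Z.
have L_gt0 : 0 < L by rewrite mulr_gt0 ?expR_gt0.
have qE v : expR (- zeta v) = L * q v.
  by rewrite /L /q /zeta opprB expRD; field; rewrite gt_eqF.
have qzE v : q v * expR (zeta v) = L^-1.
  apply: (mulfI (lt0r_neq0 L_gt0)); rewrite mulrA -qE mulfV ?gt_eqF //.
  by rewrite -expRD addNr expR0.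
pose B := #|T|%:R / L.
have B_gt0 : 0 < B by rewrite divr_gt0.
(* Multiplying by [expR (zeta v)] undoes the tilt, so this tilted mean reduces to a uniform mean of
   [zeta], which is known. *)
have BE : \sum_v q v * (zeta v * (expR (zeta v) - 1)) = (t - mu) * B.
  rewrite (eq_bigr (fun v => zeta v / L - q v * zeta v)); last first.
    by move=> v _; rewrite -(qzE v); ring.
  rewrite big_split /= sumrN qz subr0 -big_distrl /= big_split /= sumrN sumr_const.
  by rewrite -big_distrr /= EX /B -mulr_natr; field; rewrite gt_eqF.
(* [d - zeta v = t - t * X v] sums to 0 over [v], and its exponential is proportional to [q v].
   Summing [mul_expm1_le] therefore gives [#|T| <= e L (1 - d (1/2 - t/12))], and
   [1 - x <= expR (- x)] finishes. *)
have B_le : B <= expR ((t - mu) * (1 / 2 + t / 12)).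
  pose d := t - mu; pose e := expR d.
  have e_gt0 : 0 < e by apply: expR_gt0.
  have zE v : expR (d - zeta v) = e * L * q v by rewrite expRD qE mulrA.
  have s0 : \sum_v (d - zeta v) = 0.
    rewrite big_split /= sumrN sumr_const /zeta big_split /= -big_distrr /= EX.
    by rewrite sumr_const -mulr_natr /d -mulr_natr; ring.
  have sz : \sum_v q v * (d - zeta v) = d.
    rewrite (eq_bigr (fun v => q v * d - q v * zeta v)); last first.
      by move=> v _; rewrite mulrBr.
    by rewrite big_split /= sumrN qz qc subr0.
  have le1 : (1 / 2 - t / 12) * (e * L * d) <= e * L - #|T|%:R.
    rewrite -[in leLHS]sz -[X in _ <= X * _ - _]mulr1.
    have -> : e * 1 * L - #|T|%:R = \sum_v (expR (d - zeta v) - 1 - (d - zeta v)).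
      rewrite big_split /= [X in _ = _ + X]sumrN s0 subr0 big_split /= sumrN sumr_const.
      by congr (_ - _); under eq_bigr do rewrite zE; rewrite -big_distrr /= q1; ring.
    have -> : (1 / 2 - t / 12) * (e * L * \sum_v q v * (d - zeta v)) =
       \sum_v (1 / 2 - t / 12) * ((d - zeta v) * (expR (d - zeta v) - 1)).
      rewrite -big_distrr /=; congr (_ * _).
      rewrite [RHS](eq_bigr (fun v => e * L * (q v * (d - zeta v)) - (d - zeta v))).
        by rewrite big_split /= sumrN s0 subr0 big_distrr.
      by move=> v _; rewrite zE; ring.
    apply: ler_sum => v _; apply: mul_expm1_le; first exact: ltW.
    by rewrite lerBlDr /d; have := zeta_ge v; lra.
  have eL_gt0 : 0 < e * L by rewrite mulr_gt0.
  have -> : (t - mu) * (1 / 2 + t / 12) = d - d * (1 / 2 - t / 12).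
    by rewrite /d; field.
  rewrite expRD -/e.
  apply: (@le_trans _ _ (e * (1 - d * (1 / 2 - t / 12)))).
    by rewrite /B ler_pdivrMr //; lra.
  by rewrite ler_wpM2l ?(ltW e_gt0) // expR_ge1Dx.
pose mq F := m%:R * \sum_v q v * F (zeta v) : R.
have le_mq (F G : R -> R) : (forall v, F (zeta v) <= G (zeta v)) -> mq F <= mq G.
  move=> FG; rewrite ler_wpM2l ?(ltW m_gt0) //.
  by apply: ler_sum => v _; rewrite ler_wpM2l ?q_ge0.
pose K := mq (fun x => x ^+ 2).
pose Ls := mq (fun x => x ^+ 3 / 9 + 2 * x ^+ 4 / 81).
pose b := a * B.
have bE : mq (fun x => x * (expR x - 1)) = b by rewrite /mq BE /b /a mulrA.
have mqZ c F : mq (fun x => c * F x) = c * mq F.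
  rewrite /mq [RHS]mulrCA; congr (_ * _); rewrite big_distrr.
  by apply: eq_bigr => v _ /=; ring.
have mqD F G : mq (fun x => F x + G x) = mq F + mq G.
  by rewrite /mq -mulrDr -big_split /=; congr (_ * _); apply: eq_bigr => v _ /=; ring.
have main : 7 / 50 * B ^+ m <= 1 + K / 9 - Ls - 2 / 27 * (1 - m%:R^-1) * K ^+ 2.
  apply: (@tilt_inequality _ _ t a b K Ls _ B) => //.
  - by rewrite invr_ge0 (ltW m_gt0) /= div1r lef_pV2 ?posrE // ler_nat.
  - exact: ltW.
  - exact: ltW.
  - apply: le_trans B_le _; rewrite ler_expR.
    suff -> : a * (1 / 2 + t / 12) * m%:R^-1 = (t - mu) * (1 / 2 + t / 12) by [].
    by rewrite /a; field; rewrite gt_eqF.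
  - have -> : a * (1 / 2 + t / 12) = (t - mu) * (1 / 2 + t / 12) * m%:R.
      by rewrite /a; ring.
    by rewrite expRM_natr lerXn2r ?nnegrE ?expR_ge0 ?(ltW B_gt0).
  - rewrite /K mulr_ge0 ?(ltW m_gt0) // sumr_ge0 // => v _.
    by rewrite mulr_ge0 // sqr_ge0.
  - rewrite -bE -mqZ; apply: le_mq => v; apply: sqr_le_mul_expm1; first exact: ltW.
    by apply: le_trans (zeta_ge v); rewrite lerN2.
  - rewrite -bE mulrC -mqZ; apply: le_mq => v; rewrite [leRHS]mulrC.
    apply: cubic_quartic_le_mul_expm1.
    by have := zeta_ge v; lra.
  - move=> t_le2; suff : K + 9 / 2 * Ls <= b by lra.
    rewrite -bE /K /Ls -mqZ -mqD; apply: le_mq => v.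
    by have := @quartic_le_mul_expm1 _ (zeta v); have := zeta_ge v; lra.
have -> : #|T|%:R ^+ m = L ^+ m * B ^+ m.
  by rewrite -exprMn /B mulrC divfK // gt_eqF.
rewrite mulrCA; apply: le_trans (ler_wpM2l (exprn_ge0 m (ltW L_gt0)) main) _.
(* These are the coefficients of [tail_quartic (- s)]; the products of two squares in the fourth
   moment produce the term in [K ^+ 2]. *)
have := @iid_mean_quartic _ _ q zeta m 1 1 (1 / 9) (- (1 / 9)) (- (2 / 81)) q1 qz.
set F := (fun s : R => _).
set S2 := \sum_v q v * zeta v ^+ 2; set S3 := \sum_v q v * zeta v ^+ 3.
set S4 := \sum_v q v * zeta v ^+ 4 => meanE.
have -> : 1 + K / 9 - Ls - 2 / 27 * (1 - m%:R^-1) * K ^+ 2 = iid_mean q zeta m F.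
  rewrite meanE; have -> : Ls = m%:R * (S3 / 9 + 2 * S4 / 81).
    rewrite /Ls /mq; congr (_ * _); rewrite /S3 /S4.
    rewrite -[X in _ = X / 9 + _]mulr1.
    under eq_bigr do rewrite mulrDr.
    rewrite big_split /= mulr1 [2 * _]mulrC -mulrA !big_distrl /=; congr (_ + _).
      by apply: eq_bigr => v _; ring.
    by apply: eq_bigr => v _; ring.
  by rewrite /K /mq -/S2; field; rewrite gt_eqF.
rewrite /iid_mean big_distrr /=; apply: ler_sum => f _.
set s := \sum_i zeta (f i).
have sE : s = t * (\sum_i X (f i)) - m%:R * mu.
  rewrite /s /zeta big_split /= sumrN sumr_const card_ord.
  by rewrite [m%:R * _]mulr_natl big_distrr.
have -> : (\sum_i X (f i) < m%:R + 98 / 100) = (- 3 < - s).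
  by rewrite ltrN2 sE -muE ltrD2r ltr_pM2l.
apply: le_trans (expR_mul_tail_quartic_le (- s)); rewrite mulrA.
have -> : L ^+ m * \prod_i q (f i) = expR (- s).
  rewrite /s -sumrN expR_sum -[m in L ^+ m]card_ord -prodr_const -big_split /=.
  by apply: eq_bigr => i _; rewrite qE.
by rewrite /F /tail_quartic ler_wpM2l ?expR_ge0 //; lra.
Qed.

Lemma feige_small (R : realType) (T : finType) (X : T -> R) (m : nat) :
  (m <= 6)%N -> (0 < #|T|)%N -> (forall v, 0 <= X v) -> \sum_v X v = #|T|%:R ->
  7 / 50 * #|T|%:R ^+ m <=
  \sum_(f : {ffun 'I_m -> T}) (\sum_i X (f i) < m%:R + 98 / 100)%R%:R :> R.
Proof.
move=> m_le T_gt0 X_ge0 EX.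
have N_gt0 : 0 < #|T|%:R :> R by rewrite ltr0n.
have N0 : #|T|%:R != 0 :> R by rewrite gt_eqF.
pose q (v : T) : R := #|T|%:R^-1; pose z v := X v - 1.
have q1 : \sum_v q v = 1 by rewrite sumr_const -[LHS]mulr_natr mulVf.
have qz : \sum_v q v * z v = 0.
  by rewrite -big_distrr /= big_split /= sumrN sumr_const EX subrr mulr0.
have d_gt0 : 0 < m%:R + 98 / 100 :> R by rewrite ltr_wpDl //; lra.
pose c : R := (m%:R + 98 / 100)^-1.
(* Markov's inequality: the indicator is at least [1 - c * S], here written in terms of the centred
   sum. *)
have := @iid_mean_quartic _ _ q z m (1 - m%:R * c) (- c) 0 0 0 q1 qz.
rewrite !mul0r !addr0 => meanE.
have m_le6 : m%:R <= 6 :> R by rewrite ler_nat.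
have c_le : 7 / 50 <= 1 - m%:R * c.
  by rewrite /c lerBrDl -lerBrDr ler_pdivrMr //; lra.
rewrite -(ler_pM2l (_ : 0 < (#|T|%:R ^+ m)^-1)) ?invr_gt0 ?exprn_gt0 //.
rewrite mulrCA mulVf ?expf_neq0 // mulr1; apply: le_trans c_le _.
rewrite -meanE big_distrr /=; apply: ler_sum => f _.
rewrite prodr_const card_ord /q exprVn ler_wpM2l ?invr_ge0 ?exprn_ge0 //.
rewrite big_split /= sumrN sumr_const card_ord.
set S := \sum_i X (f i).
have S_ge0 : 0 <= S by apply: sumr_ge0.
rewrite !mul0r !addr0.
have -> : 1 - m%:R * c + - c * (S - 1 *+ m) = 1 - S * c by ring.
have [_|S_ge] := ltP S; last by rewrite subr_le0 -ler_pdivrMr ?invr_gt0 // invrK mul1r.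
by rewrite gerBl mulr_ge0 // invr_ge0 ltW.
Qed.

Lemma feige (R : realType) (T : finType) (X : T -> R) (m : nat) :
  (forall v, 0 <= X v) -> \sum_v X v <= #|T|%:R ->
  7 / 50 * #|T|%:R ^+ m <=
  \sum_(f : {ffun 'I_m -> T}) (\sum_i X (f i) < m%:R + 98 / 100)%R%:R :> R.
Proof.
move=> X_ge0 EX; have d_gt0 : 0 < m%:R + 98 / 100 :> R by rewrite ltr_wpDl //; lra.
have all_good : (forall v, X v = 0) -> 7 / 50 * #|T|%:R ^+ m <=
    \sum_(f : {ffun 'I_m -> T}) (\sum_i X (f i) < m%:R + 98 / 100)%R%:R :> R.
  move=> X0; rewrite (eq_bigr (fun=> 1)) => [|f _].
    rewrite sumr_const card_ffun card_ord natrX ler_piMl ?exprn_ge0 //.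
    by lra.
  by rewrite big1 // d_gt0.
have [s_gt0|s_le0] := ltP 0 (\sum_v X v); last first.
  apply: all_good => v; apply/eqP; rewrite -[_ == _]negbK; apply/negP => Xv.
  suff : 0 < \sum_v X v by rewrite ltNge s_le0.
  by rewrite (bigD1 v) //= ltr_pwDl ?sumr_ge0 // lt_neqAle eq_sym Xv X_ge0.
have [T0|T_gt0] := posnP #|T|.
  by apply: all_good => v; have := card0_eq T0 v.
set s := \sum_v X v in EX s_gt0.
(* Scaling up to mean exactly 1 can only shrink the event. *)
pose X' v := #|T|%:R / s * X v.
have X'_ge0 v : 0 <= X' v by rewrite !mulr_ge0 ?invr_ge0 // ltW.
have EX' : \sum_v X' v = #|T|%:R by rewrite -big_distrr /= -/s divfK ?gt_eqF.
apply: (@le_trans _ _ (\sum_(f : {ffun 'I_m -> T})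
    (\sum_i X' (f i) < m%:R + 98 / 100)%R%:R)).
  have [m_le|m_gt] := leqP m 6; first exact: feige_small.
  exact: feige_large.
apply: ler_sum => f _; rewrite ler_nat.
have le_X v : X v <= X' v by rewrite /X' ler_peMl // ler_pdivlMr // mul1r.
case: ltP => // lt_X'; rewrite (le_lt_trans _ lt_X') //.
by apply: ler_sum => i _; apply: le_X.
Qed.

(** * Balanced sequences *)

(** Tuples that are light for [w] have density at least [7/50], so they meet [G]. When [X] consists
    of [t] rows of [r + 1] positions, the bound is smaller than the average weight of a row. *)
Lemma light_member (R : realType) (X : finType) (r : nat)
    (G : {set {ffun 'I_r -> X}}) (w : X -> R) :
  (43 / 50) * #|X|%:R ^+ r < #|G|%:R :> R -> (forall x, 0 <= w x) ->
  exists2 h, h \in G &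
    \sum_i w (h i) <= (r%:R + 98 / 100) / #|X|%:R * \sum_x w x.
Proof.
move=> G_large w_ge0; set W := \sum_x w x.
have W_ge0 : 0 <= W by apply: sumr_ge0.
have [W0|W_neq0] := eqVneq W 0.
  have [h hG] : exists h, h \in G.
    apply/set0Pn; apply: contraTneq G_large => ->; rewrite cards0 -leNgt.
    by rewrite mulr_ge0 ?exprn_ge0 //; lra.
  exists h => //; rewrite W0 mulr0 big1 // => i _.
  by apply: (@psumr_eq0P _ _ predT w).
have W_gt0 : 0 < W by rewrite lt_neqAle eq_sym W_neq0.
have X_gt0 : 0 < #|X|%:R :> R.
  rewrite ltr0n; apply/card_gt0P.
  have [x _] : exists x, w x != 0 by apply/existsP; apply: contra_neqT W_neq0;
    rewrite negb_exists => /forallP w0; rewrite /W big1 // => x _; apply/eqP; rewrite -[_ == _]negbK.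
  by exists x.
pose X' x := #|X|%:R / W * w x.
have X'_ge0 x : 0 <= X' x by rewrite !mulr_ge0 // invr_ge0 ltW.
have EX' : \sum_x X' x <= #|X|%:R by rewrite -big_distrr /= -/W divfK.
have := feige r X'_ge0 EX'.
set good := fun f : {ffun 'I_r -> X} => \sum_i X' (f i) < r%:R + 98 / 100.
rewrite -(natr_sum _ _ _ _) -big_mkcond /= => feigeE.
have [h hG h_good] : exists2 h, h \in G & good h.
  apply/exists_inP; apply: contraLR feigeE => /exists_inPn G_bad.
  rewrite -ltNge sum1_card.
  have : (#|[pred f | good f]| + #|G| <= #|X| ^ r)%N.
    rewrite -[in leqRHS](card_ord r) -card_ffun -cardUI.
    have -> : #|[predI [pred f | good f] & G]| = 0%N.
      apply: eq_card0 => h; rewrite !inE; apply/andP => -[h1 h2].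
      by have := G_bad h h2; rewrite h1.
    by rewrite addn0 max_card.
  by rewrite -(ler_nat R) natrD natrX; lra.
exists h => //.
move: h_good; rewrite /good /X' -big_distrr /= => /ltW.
set S := \sum_i w (h i) => le_h.
have -> : S = (#|X|%:R / W * S) * (W / #|X|%:R) by field; rewrite W_neq0 gt_eqF.
rewrite [leRHS]mulrAC -[leRHS]mulrA ler_wpM2r // divr_ge0 // ltW.
Qed.

(* Blackwell approachability: always adding a function that is light for the
   weights [(load - c s)^+] keeps the sum of their squares linear in [s]. *)
Lemma balanced_seq (R : realType) (X : finType) (r : nat)
    (G : {set {ffun 'I_r -> X}}) (c : R) :
  (43 / 50) * #|X|%:R ^+ r < #|G|%:R :> R -> c = (r%:R + 98 / 100) / #|X|%:R ->
  forall s, exists H : seq {ffun 'I_r -> X},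
    [/\ size H = s, {subset H <= G} &
      forall x, c * s%:R <= (load H x)%:R ->
      ((load H x)%:R - c * s%:R) ^+ 2 <= #|X|%:R * (r%:R + c) ^+ 2 * s%:R].
Proof.
move=> G_large cE s.
have c_ge0 : 0 <= c by rewrite cE divr_ge0 // addr_ge0 //; lra.
pose w (H : seq {ffun 'I_r -> X}) x := Num.max 0 ((load H x)%:R - c * (size H)%:R).
have w_ge0 H x : 0 <= w H x by rewrite le_max lexx.
suff [H [sH HG Phi]] : exists H : seq {ffun 'I_r -> X},
    [/\ size H = s, {subset H <= G} &
      \sum_x w H x ^+ 2 <= #|X|%:R * (r%:R + c) ^+ 2 * s%:R].
  exists H; split => // x le_x; apply: le_trans Phi.
  rewrite (bigD1 x) //= /w sH (max_idPr _) ?subr_ge0 // lerDl.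
  by apply: sumr_ge0 => y _; apply: sqr_ge0.
elim: s => [|s [H [sH HG Phi]]].
  exists [::]; split => //; rewrite mulr0 big1 // => x _.
  by rewrite /w /load big_nil mulr0 subrr maxxx expr0n.
have [h hG h_light] := light_member G_large (w_ge0 H).
rewrite -cE in h_light.
exists (h :: H); split => //=; first by rewrite sH.
  by move=> g; rewrite inE => /predU1P[->|/HG].
pose u x : R := #|[set i | h i == x]|%:R.
have u_le x : u x <= r%:R.
  by rewrite ler_nat (leq_trans (max_card _)) // card_ord.
have u_ge0 x : 0 <= u x by [].
have w_rec x : w (h :: H) x ^+ 2 <= (w H x + (u x - c)) ^+ 2.
  rewrite /w /load big_cons -/(load H x) /= natrD -/(u x) -addn1 natrD.
  case: (leP 0 (u x + (load H x)%:R - c * ((size H)%:R + 1))) => [ge0|_].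
    rewrite ler_sqr ?nnegrE //; last first.
      apply: le_trans ge0 _.
      have : (load H x)%:R - c * (size H)%:R <= Num.max 0 ((load H x)%:R - c * (size H)%:R).
        by rewrite le_max lexx orbT.
      by lra.
    have : (load H x)%:R - c * (size H)%:R <= Num.max 0 ((load H x)%:R - c * (size H)%:R).
      by rewrite le_max lexx orbT.
    by lra.
  by rewrite expr0n sqr_ge0.
have uw : \sum_x w H x * u x = \sum_i w H (h i).
  rewrite (partition_big h xpredT) //=; apply: eq_bigr => x _.
  rewrite (eq_bigr (fun=> w H x)); last by move=> i /eqP ->.
  by rewrite sumr_const /u mulr_natr; congr (_ *+ _); apply: eq_card => i; rewrite inE.
apply: (@le_trans _ _ (\sum_x (w H x + (u x - c)) ^+ 2)).
  by apply: ler_sum => x _; apply: w_rec.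
(* The middle term is nonpositive because [h] is light for [w H], so one step adds at most the last
   sum to the potential. *)
have -> : \sum_x (w H x + (u x - c)) ^+ 2 = \sum_x w H x ^+ 2 +
    2 * (\sum_x w H x * u x - c * \sum_x w H x) + \sum_x (u x - c) ^+ 2.
  rewrite mulrBr !big_distrr /= -sumrB -!big_split /=.
  by apply: eq_bigr => x _; ring.
have last_le : \sum_x (u x - c) ^+ 2 <= #|X|%:R * (r%:R + c) ^+ 2.
  have -> : #|X|%:R * (r%:R + c) ^+ 2 = \sum_(x : X) (r%:R + c) ^+ 2.
    by rewrite sumr_const mulr_natl.
  apply: ler_sum => x _; rewrite -real_normK ?num_real //.
  rewrite lerXn2r ?nnegrE ?addr_ge0 // ler_norml.
  by have := u_le x; have := u_ge0 x; lra.
by rewrite uw -addn1 natrD; lra.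
Qed.

Lemma exists_nat_ge (R : realType) (x : R) : exists n : nat, x <= n%:R.
Proof.
exists (Num.bound `|x|); apply: le_trans (ler_norm x) _.
by rewrite ltW // archi_boundP.
Qed.

(** After [t q + 1] steps the average load is [(1 - g) q + c], and the slack [g q] outgrows the
    deviation of order [sqrt q]. The size [q] has to be uniform in [G], because the box is chosen
    large enough before the pattern is known. *)
Lemma balanced_pattern (R : realType) (r t : nat) : (0 < t)%N ->
  exists q : nat, forall G : {set {ffun 'I_r -> 'I_t * 'I_r.+1}},
    43 / 50 * (t * r.+1)%:R ^+ r < #|G|%:R :> R ->
    exists H : seq {ffun 'I_r -> 'I_t * 'I_r.+1},
      [/\ size H = (t * q.+1).+1, {subset H <= G} & forall x, (load H x <= q.+1)%N].
Proof.
move=> t_gt0.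
have tR : 0 < t%:R :> R by rewrite ltr0n.
have t_ge1 : 1 <= t%:R :> R by rewrite ler1n.
pose g : R := 2 / 100 / r.+1%:R.
have k_gt0 : 0 < r.+1%:R :> R by rewrite ltr0n.
have g_gt0 : 0 < g by rewrite !divr_gt0 //; lra.
have r_ge0 : 0 <= r%:R :> R by [].
have cardE : #|{: 'I_t * 'I_r.+1}| = (t * r.+1)%N by rewrite card_prod !card_ord.
pose c : R := (r%:R + 98 / 100) / #|{: 'I_t * 'I_r.+1}|%:R.
have cE : c * t%:R = 1 - g.
  rewrite /c cardE natrM /g -[r.+1]addn1 natrD; field.
  by rewrite -natr1 in k_gt0; rewrite !gt_eqF // lra.
have c_ge0 : 0 <= c by rewrite /c divr_ge0 //; lra.
have c_le1 : c <= 1.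
  by have := ler_wpM2l c_ge0 t_ge1; lra.
pose C : R := #|{: 'I_t * 'I_r.+1}|%:R * (r%:R + c) ^+ 2.
have C_ge0 : 0 <= C by rewrite mulr_ge0 // sqr_ge0.
have [q1 q1_ge] := exists_nat_ge (2 / g).
have [q2 q2_ge] := exists_nat_ge (4 * C * (t%:R + 1) / g ^+ 2).
pose q := maxn 1 (maxn q1 q2).
have qR1 : 1 <= q%:R :> R by rewrite ler1n leq_maxl.
have qR2 : 2 <= g * q%:R.
  rewrite mulrC -ler_pdivrMr //; apply: le_trans q1_ge _.
  by rewrite ler_nat !leq_max leqnn /= orbT.
have qR3 : 4 * C * (t%:R + 1) <= g ^+ 2 * q%:R.
  rewrite mulrC [leRHS]mulrC -ler_pdivrMr ?exprn_gt0 //.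
  rewrite [_ * (4 * C)]mulrC; apply: le_trans q2_ge _.
  by rewrite ler_nat !leq_max leqnn !orbT.
exists q.-1 => G G_large.
have q_gt0 : (0 < q)%N by rewrite leq_maxl.
rewrite prednK //.
have [||H [sH HG Hload]] := @balanced_seq R _ _ G c _ _ (t * q).+1 => //.
  by rewrite cardE.
exists H; split => // x; rewrite leqNgt; apply/negP => load_gt.
have load_gtR : q%:R + 1 <= (load H x)%:R :> R by rewrite natr1 ler_nat.
have sE : c * (t * q).+1%:R = (1 - g) * q%:R + c.
  by rewrite -natr1 natrM mulrDr mulr1 mulrA cE.
have y_ge : g * q%:R <= (load H x)%:R - ((1 - g) * q%:R + c) by lra.
have gq_ge0 : 0 <= g * q%:R by lra.
have y2_le : ((load H x)%:R - ((1 - g) * q%:R + c)) ^+ 2 <= C * (t * q).+1%:R.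
  by rewrite -sE; apply: Hload; rewrite sE; lra.
have y2_ge := lerXn2r 2 gq_ge0 (le_trans gq_ge0 y_ge) y_ge.
have : C * (t * q).+1%:R <= (g ^+ 2 * q%:R) / 4 * q%:R.
  apply: (@le_trans _ _ (C * (t%:R + 1) * q%:R)).
    by rewrite -mulrA ler_wpM2l // -natr1 natrM; lra.
  by rewrite ler_wpM2r //; lra.
have : 0 < g * q%:R by lra.
by move=> /(exprn_gt0 2); lra.
Qed.

(** * Boxes in dense sets *)

Lemma markov_card (R : realFieldType) (T : finType) (A : {set T}) (F : T -> R) (M a : R) :
  (forall x, F x <= M) -> 0 <= a ->
  \sum_(x in A) F x <= #|[set x in A | a <= F x]|%:R * M + a * #|A|%:R.
Proof.
move=> F_le a_ge0.
rewrite (bigID (fun x => a <= F x)) /= lerD //.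
  rewrite -sum1dep_card natr_sum big_distrl /=.
  by apply: ler_sum => x _; rewrite mul1r.
apply: (@le_trans _ _ (\sum_(x in A) a)); last by rewrite sumr_const mulr_natr.
rewrite [leRHS](bigID (fun x => a <= F x)) /= ler_wpDl ?sumr_ge0 //.
by apply: ler_sum => x /andP[_]; rewrite -ltNge => /ltW.
Qed.

Lemma ffact_ge (n q : nat) : ((n - q) ^ q <= n ^_ q)%N.
Proof.
suff H j : (j <= q -> (n - q) ^ j <= n ^_ j)%N by apply: H.
elim: j => [|j IH] // lt_jq; rewrite expnSr ffactnSr leq_mul //.
  by apply: IH; apply: ltnW.
by rewrite leq_sub2l // ltnW.
Qed.

Lemma natr_card (R : pzSemiRingType) (T : finType) (A : {pred T}) :
  #|A|%:R = \sum_x (x \in A)%:R :> R.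
Proof.
by rewrite -sum1_card natr_sum big_mkcond; apply: eq_bigr => x _; case: (x \in A).
Qed.

Lemma exists_ge_average (R : realFieldType) (T : finType) (P : pred T)
    (F : T -> R) (M : R) :
  (0 < #|T|)%N -> 0 <= M -> (forall x, ~~ P x -> F x <= 0) ->
  M * #|T|%:R < \sum_x F x -> exists2 x, P x & M <= F x.
Proof.
move=> T_gt0 M_ge0 F_le0 avg; apply/exists_inP; apply: contraLR avg.
move=> /exists_inPn F_small; rewrite -leNgt mulr_natr -sumr_const.
apply: ler_sum => x _; case: (boolP (P x)) => Px.
  by apply: ltW; rewrite ltNge; apply: F_small.
by apply: le_trans M_ge0; apply: F_le0.
Qed.

(** A positive share of the [y] have at least [(a / 2) #|A|] neighbours, hence at least
    [((a / 4) #|A|) ^ q] injective tuples of neighbours; some tuple is counted for many [y]. Halving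
    the constant once more makes the average strictly larger than the target. *)
Lemma common_neighbours (R : realType) (q : nat) (a : R) : 0 < a ->
  exists n0 : nat, exists2 b : R, 0 < b &
    forall (A B : finType) (S : {set A * B}), (n0 <= #|A|)%N ->
      a * #|A|%:R * #|B|%:R <= #|S|%:R ->
      exists2 f : {ffun 'I_q -> A}, injective f &
        b * #|B|%:R <= #|[set y | [forall i, (f i, y) \in S]]|%:R.
Proof.
move=> a_gt0.
have [n0 n0_ge] := exists_nat_ge (4 * q%:R / a).
exists (maxn 1 (maxn q n0)), (a / 4 * (a / 4) ^+ q).
  by rewrite mulr_gt0 ?exprn_gt0 // ?divr_gt0.
move=> A B S; rewrite !geq_max => /and3P[A_gt0 A_geq A_ge] S_ge.
have AR : 0 < #|A|%:R :> R by rewrite ltr0n.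
have A_geR : 4 * q%:R <= a * #|A|%:R.
  have le_q : 4 * q%:R / a <= #|A|%:R by apply: le_trans n0_ge _; rewrite ler_nat.
  by rewrite ler_pdivrMr // [_ * a]mulrC in le_q.
pose N y := [set x | (x, y) \in S].
have SE : #|S|%:R = \sum_y #|N y|%:R :> R.
  rewrite natr_card (eq_bigr (fun p => ((p.1, p.2) \in S)%:R)); last by case.
  rewrite -(pair_bigA _ (fun x y => ((x, y) \in S)%:R)) /= exchange_big /=.
  by apply: eq_bigr => y _; rewrite natr_card; apply: eq_bigr => x _; rewrite inE.
pose F y : R := #|N y|%:R.
have F_le y : F y <= #|A|%:R by rewrite ler_nat max_card.
have aA_ge0 : 0 <= a / 2 * #|A|%:R by rewrite mulr_ge0 // divr_ge0 // ltW.
have := markov_card [set: B] F_le aA_ge0.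
rewrite (eq_bigl xpredT) => [|y]; last exact: in_setT.
rewrite cardsT /F -SE; set B' := [set y in _ | _] => S_le.
have B'_ge : a / 2 * #|B|%:R <= #|B'|%:R.
  rewrite -(ler_pM2r AR).
  have := le_trans S_ge S_le; lra.
pose G (f : {ffun 'I_q -> A}) : R :=
  \sum_y (injectiveb f && [forall i, (f i, y) \in S])%:R.
have G_sum : a / 2 * (a / 4) ^+ q * #|B|%:R * #|{ffun 'I_q -> A}|%:R <= \sum_f G f.
  rewrite /G exchange_big /= card_ffun card_ord natrX.
  apply: (@le_trans _ _ (\sum_(y in B') (a / 4 * #|A|%:R) ^+ q)).
    rewrite sumr_const -[leRHS]mulr_natl [(_ * #|A|%:R) ^+ q]exprMn.
    rewrite [_ * _ * #|B|%:R]mulrAC -[leLHS]mulrA.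
    by rewrite ler_wpM2r // mulr_ge0 ?exprn_ge0 // divr_ge0 // ltW.
  rewrite [leRHS](bigID (mem B')) /= ler_wpDr //.
    by apply: sumr_ge0 => y _; apply: sumr_ge0.
  apply: ler_sum => y; rewrite !inE /= => Ny.
  apply: (@le_trans _ _ (#|N y| ^_ q)%:R).
    apply: (@le_trans _ _ ((#|N y| - q) ^ q)%:R); last by rewrite ler_nat ffact_ge.
    rewrite natrX lerXn2r ?nnegrE //; first by rewrite mulr_ge0 // divr_ge0 // ltW.
    have q_le : (q <= #|N y|)%N by rewrite -(ler_nat R); lra.
    by rewrite natrB //; lra.
  have := card_inj_ffuns_on 'I_q (mem (N y)); rewrite card_ord => <-.
  rewrite natr_card; apply: ler_sum => f _; rewrite ler_nat !inE.
  case: (boolP (_ && _)) => // /andP[/ffun_onP f_on ->] /=.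
  by rewrite (introT forallP) // => i; have := f_on i; rewrite inE.
have inj_gt0 : (0 < #|[set f : {ffun 'I_q -> A} | injectiveb f]|)%N.
  by rewrite card_inj_ffuns card_ord ffact_gt0.
have [B0|B_gt0] := posnP #|B|.
  have /card_gt0P[f] := inj_gt0; rewrite inE => /injectiveP f_inj.
  by exists f => //; rewrite B0 mulr0.
have T_gt0 : (0 < #|{ffun 'I_q -> A}|)%N.
  by apply: leq_trans inj_gt0 (max_card _).
have M_ge0 : 0 <= a / 4 * (a / 4) ^+ q * #|B|%:R.
  have a4_ge0 : 0 <= a / 4 by rewrite divr_ge0 // ltW.
  by rewrite mulr_ge0 // mulr_ge0 // exprn_ge0.
have [||f f_inj f_ge] := @exists_ge_average R _
  (fun f : {ffun 'I_q -> A} => injectiveb f) G _ T_gt0 M_ge0.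
- by move=> f /negbTE f_inj; rewrite /G f_inj big1.
- apply: lt_le_trans G_sum; rewrite ltr_pM2r ?ltr0n // -!mulrA.
  rewrite ltr_pM2l // ltr_pM2r; first by rewrite ltf_pV2 ?posrE // ltr_nat.
  by rewrite mulr_gt0 ?exprn_gt0 ?divr_gt0 ?ltr0n.
exists f; first exact/injectiveP.
apply: le_trans f_ge _; rewrite natr_card; apply: ler_sum => y _.
by rewrite inE ler_nat; case: (injectiveb f).
Qed.

(** Erdos's argument for complete multipartite hypergraphs, keeping one side of positive density: a
    coordinate is first merged with [B], a box is found in the remaining ones, and
    [common_neighbours] then separates that coordinate again. *)
Lemma box_lemma (R : realType) (q t : nat) (a : R) : 0 < a ->
  exists n0 : nat, exists2 b : R, 0 < b &
    forall (A B : finType) (S : {set {ffun 'I_t -> A} * B}), (n0 <= #|A|)%N ->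
      a * #|A|%:R ^+ t * #|B|%:R <= #|S|%:R ->
      exists2 Q : {ffun 'I_t -> {ffun 'I_q -> A}}, (forall i, injective (Q i)) &
        b * #|B|%:R <=
        #|[set y | [forall g : {ffun 'I_t -> 'I_q}, ([ffun i => Q i (g i)], y) \in S]]|%:R.
Proof.
elim: t a => [|t IH] a a_gt0.
  exists 0%N, a => // A B S _; rewrite mulr1 => S_ge.
  exists (ffun0 (card_ord 0)); first by case.
  apply: le_trans S_ge _; rewrite ler_nat.
  have f0 (f g : {ffun 'I_0 -> A}) : f = g by apply/ffunP; case.
  have snd_inj : {in S &, injective (fun p : {ffun 'I_0 -> A} * B => p.2)}.
    by move=> [f y] [g z] _ _ /= ->; rewrite (f0 f g).
  rewrite -(card_in_imset snd_inj).
  apply: subset_leq_card; apply/subsetP => z /imsetP[[f y] fyS zE]; rewrite zE.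
  rewrite inE; apply/forallP => g; move: fyS; congr (is_true ((_, _) \in S)); apply: f0.
have [n1 [b1 b1_gt0 IH1]] := IH a a_gt0.
have [n2 [b2 b2_gt0 nb]] := common_neighbours q b1_gt0.
exists (maxn n1 n2), b2 => // A B S; rewrite geq_max => /andP[A_ge1 A_ge2] S_ge.
pose S' : {set {ffun 'I_t -> A} * (A * B)} :=
  [set p | (fcons p.2.1 p.1, p.2.2) \in S].
have S'E : #|S'| = #|S|.
  rewrite -!sum1_card [RHS]big_mkcond [LHS]big_mkcond /=.
  rewrite [RHS](eq_bigr (fun p => if (p.1, p.2) \in S then 1%N else 0%N)); last by case.
  rewrite -(pair_bigA _ (fun x y => if (x, y) \in S then 1%N else 0%N)) /=.
  rewrite big_ffun_recl /=.
  rewrite [LHS](eq_bigr (fun p => if (fcons p.2.1 p.1, p.2.2) \in S then 1%N else 0%N)).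
    rewrite -(pair_bigA _ (fun g y => if (fcons y.1 g, y.2) \in S then 1%N else 0%N)) /=.
    rewrite exchange_big /=.
    rewrite -(pair_bigA _ (fun x y => (\sum_g if (fcons x g, y) \in S then 1 else 0)%N)) /=.
    by apply: eq_bigr => x _; rewrite exchange_big.
  by move=> p _; rewrite inE.
have [|Q1 Q1_inj Q1_ge] := IH1 A (A * B)%type S' A_ge1.
  by rewrite S'E card_prod natrM mulrA -[a * _ * _]mulrA -exprSr.
set Y1 := [set y | _] in Q1_ge.
have [|f f_inj f_ge] := nb A B Y1 A_ge2.
  by rewrite -mulrA -natrM -card_prod.
exists (fcons f Q1).
  by move=> i; case: (unliftP ord0 i) => [j ->|->]; rewrite ?fconsS ?fcons0.
apply: le_trans f_ge _; rewrite ler_nat; apply: subset_leq_card.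
apply/subsetP => y; rewrite !inE => /forallP fy; apply/forallP => g.
have := fy (g ord0); rewrite inE => /forallP/(_ [ffun j => g (lift ord0 j)]).
rewrite inE /=; congr (is_true ((_, _) \in S)); apply/ffunP => i.
rewrite [LHS]ffunE [RHS]ffunE; case: (unliftP ord0 i) => [j ->|->].
  by rewrite fconsS !ffunE.
by rewrite fcons0.
Qed.

(** * Almost perfect matchings *)

Lemma ffact_asymp (R : realType) (q : nat) (d : R) : 0 < d ->
  exists n0 : nat, forall n, (n0 <= n)%N -> (1 - d) * n%:R ^+ q <= (n ^_ q)%:R.
Proof.
elim: q d => [|q IH] d d_gt0.
  by exists 0%N => n _; rewrite mulr1 gerBl ltW.
have [d_ge1|d_lt1] := leP 1 d.
  exists 0%N => n _; apply: (@le_trans _ _ 0) => //.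
  by rewrite mulr_le0_ge0 ?exprn_ge0 // subr_le0.
have d2_gt0 : 0 < d / 2 by rewrite divr_gt0.
have [n1 n1_ge] := IH _ d2_gt0.
have [n2 n2_ge] := exists_nat_ge (2 * q%:R / d).
exists (maxn q (maxn n1 n2)) => n; rewrite !geq_max => /and3P[le_q le_1 le_2].
rewrite ffactnSr natrM natrB // exprSr.
have q_le : q%:R <= d / 2 * n%:R.
  have : 2 * q%:R / d <= n%:R by apply: le_trans n2_ge _; rewrite ler_nat.
  by rewrite ler_pdivrMr // => le; lra.
apply: (@le_trans _ _ (((1 - d / 2) * n%:R ^+ q) * ((1 - d / 2) * n%:R))).
  have : 0 <= n%:R ^+ q * n%:R * d ^+ 2 :> R by rewrite !mulr_ge0 ?exprn_ge0 // ltW.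
  by set x := n%:R ^+ q; lra.
rewrite ler_pM //; last by lra.
- by rewrite mulr_ge0 ?exprn_ge0 //; lra.
- by rewrite mulr_ge0 //; lra.
exact: n1_ge.
Qed.

Lemma card_comp_fiber (A : finType) (r t : nat) (c : 'I_r -> 'I_t)
    (j : {ffun 'I_r -> A}) : injective c ->
  #|[set g : {ffun 'I_t -> A} | [ffun i => g (c i)] == j]| = (#|A| ^ (t - r))%N.
Proof.
move=> c_inj.
pose P s : pred A := fun x => [forall i, (c i == s) ==> (x == j i)].
transitivity #|family P|.
  apply: eq_card => g; rewrite inE; apply/eqP/familyP => [gj s|gP].
    by apply/forallP => i; apply/implyP => /eqP <-; rewrite -gj ffunE.
  apply/ffunP => i; rewrite ffunE; apply/eqP.
  by have /forallP/(_ i) := gP (c i); rewrite eqxx.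
rewrite card_family foldrE big_map big_enum /=.
rewrite (bigID (mem (codom c))) /= big1 ?mul1n => [|s /codomP[i ->]].
  rewrite (eq_bigr (fun=> #|A|)) => [|s sc].
    rewrite prod_nat_const; congr (_ ^ _)%N.
    have := cardC (mem (codom c)); rewrite card_codom //.
    rewrite [#|'I_r|]card_ord [X in _ = X]card_ord => tE.
    by rewrite -[in RHS]tE addKn; apply: eq_card.
  apply: eq_card => x; rewrite inE; apply/forallP => i; apply/implyP => /eqP cs.
  by rewrite -cs codom_f in sc.
apply: (eq_card1 (x := j i)) => x; rewrite !inE.
apply/forallP/eqP => [/(_ i)|-> i']; first by rewrite eqxx => /eqP.
by apply/implyP => /eqP/c_inj ->.
Qed.

Lemma sum_comp_inj (R : pzSemiRingType) (A : finType) (r t : nat) (c : 'I_r -> 'I_t)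
    (F : {ffun 'I_r -> A} -> R) : injective c ->
  \sum_(g : {ffun 'I_t -> A}) F [ffun i => g (c i)] =
  (#|A| ^ (t - r))%:R * \sum_j F j.
Proof.
move=> c_inj; rewrite big_distrr /=.
rewrite (partition_big (fun g : {ffun 'I_t -> A} => [ffun i => g (c i)]) xpredT) //=.
apply: eq_bigr => j _; rewrite -(card_comp_fiber j c_inj).
rewrite (eq_bigr (fun=> F j)) => [|g /eqP -> //].
by rewrite sumr_const mulr_natl; congr (_ *+ _); apply: eq_card => g; rewrite inE.
Qed.

Lemma big_ffun_pair (R : Type) (idx : R) (op : Monoid.com_law idx)
    (I A B : finType) (F : {ffun I -> A * B} -> R) :
  \big[op/idx]_h F h =
  \big[op/idx]_(c : {ffun I -> A}) \big[op/idx]_(a : {ffun I -> B})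
    F [ffun i => (c i, a i)].
Proof.
rewrite pair_big (reindex (fun p : {ffun I -> A} * {ffun I -> B} =>
  [ffun i => (p.1 i, p.2 i)])) //=.
exists (fun h : {ffun I -> A * B} => ([ffun i => (h i).1], [ffun i => (h i).2])).
  by move=> [c a] _ /=; congr (_, _); apply/ffunP => i; rewrite !ffunE.
by move=> h _; apply/ffunP => i; rewrite !ffunE /=; case: (h i).
Qed.

Lemma big_ffun_bij (R : Type) (idx : R) (op : Monoid.com_law idx)
    (I A B : finType) (b : A -> B) (F : {ffun I -> B} -> R) : bijective b ->
  \big[op/idx]_h F h = \big[op/idx]_(x : {ffun I -> A}) F [ffun i => b (x i)].
Proof.
move=> [b' bK b'K].
rewrite (reindex (fun x : {ffun I -> A} => [ffun i => b (x i)])) //=.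
exists (fun f : {ffun I -> B} => [ffun i => b' (f i)]) => f _;
  by apply/ffunP => i; rewrite !ffunE ?bK ?b'K.
Qed.

(* The (r+1)-sets of [E] through [v], counted with their orderings. *)
Definition tdeg (V : finType) (E : {set {set V}}) (r : nat) (v : V) : nat :=
  #|[set f : {ffun 'I_r -> V} | v |: [set f i | i : 'I_r] \in E]|.

Definition pattern (V : finType) (E : {set {set V}}) (r p t : nat)
    (lab : 'I_p * 'I_r.+1 -> V) (g : {ffun 'I_t -> 'I_p}) (u : V) :
    {set {ffun 'I_r -> 'I_t * 'I_r.+1}} :=
  [set h : {ffun 'I_r -> 'I_t * 'I_r.+1} | injectiveb [ffun i => (h i).1] &&
    (u |: [set lab (g (h i).1, (h i).2) | i : 'I_r] \in E)].

(** An [r]-tuple of vertices is a tuple of rows and places in them. Each injective assignment of its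
    entries to blocks fixes [g] on [r] blocks and leaves [p ^ (t - r)] extensions, so the average
    pattern density is nearly the degree density. *)
Lemma sum_pattern (R : pzSemiRingType) (V : finType) (E : {set {set V}}) (r p t : nat)
    (lab : 'I_p * 'I_r.+1 -> V) (u : V) : bijective lab ->
  \sum_g #|pattern (t := t) E lab g u|%:R =
  (t ^_ r * p ^ (t - r) * tdeg E r u)%:R :> R.
Proof.
move=> lab_bij.
pose In (x : {ffun 'I_r -> V}) : R := (u |: [set x i | i : 'I_r] \in E)%:R.
transitivity (\sum_(c : {ffun 'I_r -> 'I_t} | injectiveb c)
    \sum_(a : {ffun 'I_r -> 'I_r.+1}) \sum_(g : {ffun 'I_t -> 'I_p})
      In [ffun i => lab (g (c i), a i)]).
  rewrite [RHS]big_mkcond /=; under eq_bigr do rewrite natr_card.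
  rewrite exchange_big big_ffun_pair /=; apply: eq_bigr => c _.
  case: ifPn => c_inj; last first.
    rewrite big1 // => a _; rewrite big1 // => g _; rewrite inE.
    rewrite (_ : [ffun i => _] = c) ?(negbTE c_inj) //.
    by apply/ffunP => i; rewrite !ffunE.
  apply: eq_bigr => a _; apply: eq_bigr => g _; rewrite inE.
  rewrite (_ : [ffun i => ([ffun i0 => (c i0, a i0)] i).1] = c); last first.
    by apply/ffunP => i; rewrite !ffunE.
  rewrite c_inj /= /In; congr (_ |: _ \in E)%:R.
  by apply: eq_imset => i; rewrite !ffunE.
rewrite (eq_bigr (fun=> (p ^ (t - r) * tdeg E r u)%:R)) => [|c /injectiveP c_inj].
  rewrite sumr_const -[LHS]mulr_natr -natrM mulnC -[in RHS]mulnA; congr (_ * _)%:R.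
  by have := card_inj_ffuns 'I_r 'I_t; rewrite cardsE !card_ord => <-.
transitivity (\sum_(a : {ffun 'I_r -> 'I_r.+1})
    (p ^ (t - r))%:R * \sum_(j : {ffun 'I_r -> 'I_p}) In [ffun i => lab (j i, a i)]).
  apply: eq_bigr => a _; rewrite -[in X in _ = (X ^ _)%:R * _](card_ord p).
  rewrite -(@sum_comp_inj _ _ _ _ c (fun j => In [ffun i => lab (j i, a i)])) //.
  by apply: eq_bigr => g _; congr In; apply/ffunP => i; rewrite !ffunE.
rewrite -big_distrr /= natrM; congr (_ * _).
rewrite exchange_big /=.
rewrite /tdeg natr_card (big_ffun_bij _ _ lab_bij) big_ffun_pair /=.
apply: eq_bigr => j _; apply: eq_bigr => a _; rewrite inE /In.
congr (_ |: _ \in E)%:R; apply: eq_imset => i.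
by rewrite !ffunE.
Qed.

Lemma pigeonhole_fiber (R : realFieldType) (T T' : finType)
    (A : {set T}) (f : T -> T') (a : R) :
  0 <= a -> a * #|T'|%:R < #|A|%:R ->
  exists2 y, y \in f @: A & a < #|[set x in A | f x == y]|%:R.
Proof.
move=> a_ge0 A_gt; apply/exists_inP; apply: contraLR A_gt => /exists_inPn small.
rewrite -leNgt -sum1_card (partition_big f xpredT) //= natr_sum.
rewrite mulr_natr -sumr_const; apply: ler_sum => y _; rewrite sum1dep_card.
have [/small|yA] := boolP (y \in f @: A); first by rewrite -leNgt.
rewrite (_ : [set x | _] = set0) ?cards0 //; apply/setP => x; rewrite !inE.
by apply: contraNF yA => /andP[xA /eqP <-]; apply: imset_f.
Qed.

(* Averaging over the pairs of an injective [g] and [u] in [U] finds a dense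
   pattern [G] shared by a positive proportion of them; a box of such [g] and a
   balanced sequence in [G] then satisfy the hypotheses of [swap_matching]. *)
Lemma dense_uncovered_enlarge (R : realType) (r : nat) (eps eta : R) :
  (0 < r)%N -> 0 < eps -> eps <= 1 -> 0 < eta ->
  exists n0 : nat, forall (p : nat) (V : finType) (E M : {set {set V}}) (U : {set V}),
    (n0 <= p)%N -> #|V| = (p * r.+1)%N -> (forall e, e \in E -> #|e| = r.+1) ->
    M \subset E -> trivIset M -> [disjoint U & cover M] ->
    (forall u, u \in U -> (43 / 50 + eps) * #|V|%:R ^+ r <= (tdeg E r u)%:R) ->
    eta * #|V|%:R <= #|U|%:R ->
    exists M' : {set {set V}}, [/\ M' \subset E, trivIset M' & (#|M| < #|M'|)%N].
Proof.
move=> r_gt0 eps_gt0 eps_le1 eta_gt0.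
have eps8 : 0 < eps / 8 by rewrite divr_gt0.
have [t0 t0_ge] := ffact_asymp r eps8.
pose t := maxn t0.+1 r.
have t_gt0 : (0 < t)%N by rewrite leq_max.
have t_ge : (1 - eps / 8) * t%:R ^+ r <= (t ^_ r)%:R :> R.
  by apply: t0_ge; rewrite leq_max leqnSn.
have le_rt : (r <= t)%N by rewrite leq_maxr.
have [q q_bal] := balanced_pattern R r t_gt0.
have [p0 p0_ge] := ffact_asymp t eps8.
pose Np := #|{set {ffun 'I_r -> 'I_t * 'I_r.+1}}|.
have Np_gt0 : 0 < Np%:R :> R by rewrite ltr0n; apply/card_gt0P; exists set0.
(* A share [eps / 8 * eta] of the pairs has a dense pattern, and [Np] patterns are possible; the
   factor 2 provides the strict inequality needed by the pigeonhole. *)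
pose al : R := eps / 8 * eta / Np%:R / 2.
have al_gt0 : 0 < al by rewrite !divr_gt0 // mulr_gt0.
have [p1 [be be_gt0 box]] := box_lemma q.+1 t al_gt0.
pose m := (t * q.+1 * r.+1 + t * q.+1)%N.
have [p2 p2_ge] := exists_nat_ge ((m.+1)%:R / be).
exists (maxn 1 (maxn p0 (maxn p1 p2))) => p V E M U.
rewrite !geq_max => /and4P[p_gt0 le_p0 le_p1 le_p2] cardV Ek ME trM UM Udeg U_ge.
have [lab lab_inj Mrow] := matching_rows trM (fun e eM => Ek e (subsetP ME e eM)) cardV.
have lab_bij : bijective lab.
  by apply: inj_card_bij => //; rewrite cardV card_prod !card_ord.
have V_gt0 : 0 < #|V|%:R :> R by rewrite ltr0n cardV muln_gt0 p_gt0.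
have U_gt0 : 0 < #|U|%:R :> R by apply: lt_le_trans U_ge; rewrite mulr_gt0.
pose P : R := (t * r.+1)%:R ^+ r.
have P_gt0 : 0 < P by rewrite exprn_gt0 // ltr0n muln_gt0 t_gt0.
pose Pat (x : {ffun 'I_t -> 'I_p} * V) := pattern E lab x.1 x.2.
pose F x : R := #|Pat x|%:R.
have F_le x : F x <= P.
  rewrite /F /P -natrX ler_nat; apply: leq_trans (max_card _) _.
  by rewrite card_ffun card_prod !card_ord.
pose A := [set x : {ffun 'I_t -> 'I_p} * V | injectiveb x.1 && (x.2 \in U)].
have pt_gt0 : 0 < p%:R ^+ t :> R by rewrite exprn_gt0 // ltr0n.
have cardA : #|A|%:R <= p%:R ^+ t * #|U|%:R :> R.
  rewrite -natrX -natrM ler_nat -[p in (p ^ _)%N]card_ord -[t in (_ ^ t)%N]card_ord.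
  rewrite -card_ffun -cardsT -cardsX; apply: subset_leq_card.
  by apply/subsetP => -[g u]; rewrite !inE => /andP[_ ->].
have X_ge0 : 0 <= P * (p%:R ^+ t * #|U|%:R) by rewrite !mulr_ge0 ?exprn_ge0.
have sum_all : (1 - eps / 8) * (43 / 50 + eps) * (P * (p%:R ^+ t * #|U|%:R)) <=
    \sum_(u in U) \sum_g F (g, u).
  have -> : (1 - eps / 8) * (43 / 50 + eps) * (P * (p%:R ^+ t * #|U|%:R)) =
    \sum_(u in U) (1 - eps / 8) * (43 / 50 + eps) * (P * p%:R ^+ t).
    by rewrite sumr_const -[RHS]mulr_natr !mulrA.
  apply: ler_sum => u uU; rewrite sum_pattern // !natrM !natrX.
  have -> : (1 - eps / 8) * (43 / 50 + eps) * (P * p%:R ^+ t) =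
      (1 - eps / 8) * t%:R ^+ r * p%:R ^+ (t - r) * ((43 / 50 + eps) * #|V|%:R ^+ r).
    have pE : p%:R ^+ t = p%:R ^+ (t - r) * p%:R ^+ r :> R by rewrite -exprD subnK.
    rewrite pE /P cardV !natrM !exprMn.
    move: (t%:R ^+ r) (r.+1%:R ^+ r) (p%:R ^+ r) (p%:R ^+ (t - r)) => x1 x2 x3 x4.
    by ring.
  rewrite ler_pM ?Udeg ?mulr_ge0 ?exprn_ge0 //; try lra.
  by rewrite ler_wpM2r ?exprn_ge0.
have sum_inj : \sum_(u in U) \sum_g F (g, u) <=
    \sum_(x in A) F x + eps / 8 * (P * (p%:R ^+ t * #|U|%:R)).
  have -> : \sum_(x in A) F x =
      \sum_(u in U) \sum_(g : {ffun 'I_t -> 'I_p} | injectiveb g) F (g, u).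
    rewrite exchange_big /= pair_big /=.
    by apply: eq_big => [x|[g u] _] //; rewrite inE.
  have -> : eps / 8 * (P * (p%:R ^+ t * #|U|%:R)) = \sum_(u in U) eps / 8 * p%:R ^+ t * P.
    by rewrite sumr_const -[RHS]mulr_natr; ring.
  rewrite -big_split /=; apply: ler_sum => u _.
  rewrite (bigID (fun g : {ffun 'I_t -> 'I_p} => injectiveb g)) /= lerD2l.
  apply: (@le_trans _ _ (\sum_(g : {ffun 'I_t -> 'I_p} | ~~ injectiveb g) P)).
    by apply: ler_sum.
  rewrite sumr_const -[leLHS]mulr_natl ler_wpM2r ?(ltW P_gt0) //.
  have := cardC (fun g : {ffun 'I_t -> 'I_p} => injectiveb g).
  have := card_inj_ffuns 'I_t 'I_p; rewrite cardsE !card_ord => ->.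
  rewrite card_ffun !card_ord => /(congr1 (fun n => n%:R : R)).
  rewrite natrD natrX => cardE; have := p0_ge p le_p0.
  by set N := #|_|%:R in cardE *; lra.
(* The factor [1 - eps / 8] pays for patterns meeting distinct blocks only, the subtracted [eps / 8]
   for non-injective [g]; at least a quarter of [eps] survives since [eps <= 1]. *)
have sumF : (43 / 50 + eps / 4) * (P * (p%:R ^+ t * #|U|%:R)) <= \sum_(x in A) F x.
  have eps2 : 0 <= eps * (1 - eps) by rewrite mulr_ge0 ?subr_ge0 // ltW.
  have : 0 <= ((1 - eps / 8) * (43 / 50 + eps) - eps / 8 - (43 / 50 + eps / 4)) *
    (P * (p%:R ^+ t * #|U|%:R)).
    by rewrite mulr_ge0 //; lra.
  by move: X_ge0 sum_all sum_inj; set X := P * _; lra.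
have c_ge0 : 0 <= (43 / 50 + eps / 8) * P by rewrite mulr_ge0 ?(ltW P_gt0) //; lra.
have := markov_card A F_le c_ge0.
set S0 := [set x in A | _] => markov.
have S0_gt : eps / 8 * (p%:R ^+ t * #|U|%:R) <= #|S0|%:R.
  rewrite -(ler_pM2r P_gt0).
  have := ler_wpM2l c_ge0 cardA.
  move: markov sumF; set N := #|S0|%:R; set SF := \sum_(x in A) _.
  by set X := p%:R ^+ t * _; lra.
have [G GS G_gt] : exists2 G, G \in Pat @: S0 &
    al * (p%:R ^+ t * #|V|%:R) < #|[set x in S0 | Pat x == G]|%:R.
  apply: pigeonhole_fiber; first by rewrite mulr_ge0 ?(ltW al_gt0) // mulr_ge0 ?exprn_ge0.
  apply: lt_le_trans S0_gt.
  rewrite -/Np /al.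
  have -> : eps / 8 * eta / Np%:R / 2 * (p%:R ^+ t * #|V|%:R) * Np%:R =
    eps / 8 * p%:R ^+ t * (eta * #|V|%:R) / 2 by field; rewrite gt_eqF.
  have : eps / 8 * p%:R ^+ t * (eta * #|V|%:R) <= eps / 8 * p%:R ^+ t * #|U|%:R.
    by rewrite ler_wpM2l // mulr_ge0 // ltW.
  have : 0 < eps / 8 * p%:R ^+ t * #|U|%:R by rewrite mulr_gt0 // mulr_gt0.
  lra.
set S := [set x in S0 | _] in G_gt.
have SP g u : (g, u) \in S -> [/\ injective g, u \in U & pattern E lab g u = G].
  rewrite !inE => /andP[/andP[/andP[/injectiveP g_inj uU] _] /eqP GE].
  by split.
have [x0 x0S G_E] := imsetP GS.
have G_large : 43 / 50 * (t * r.+1)%:R ^+ r < #|G|%:R :> R.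
  move: x0S; rewrite inE => /andP[_]; rewrite /F -G_E; apply: lt_le_trans.
  by rewrite -/P ltr_pM2r //; lra.
have [H [sH HG Hload]] := q_bal G G_large.
have [||Q Q_inj Q_ge] := box 'I_p V S.
- by rewrite card_ord.
- by rewrite card_ord -mulrA ltW.
set Y := [set y | _] in Q_ge.
have Y_big : (m < #|Y|)%N.
  rewrite -(ler_nat R); apply: le_trans Q_ge.
  have : (m.+1)%:R / be <= p%:R by apply: le_trans p2_ge _; rewrite ler_nat.
  rewrite ler_pdivrMr // [_ * be]mulrC => /le_trans; apply.
  by rewrite ler_wpM2l ?(ltW be_gt0) // ler_nat cardV leq_pmulr.
have YS y (g : {ffun 'I_t -> 'I_q.+1}) : y \in Y -> ([ffun i => Q i (g i)], y) \in S.
  by rewrite inE => /forallP.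
have [y0 y0Y] : exists y0, y0 \in Y by apply/set0Pn; rewrite -card_gt0; exact: leq_ltn_trans Y_big.
apply: (swap_matching (Q := Q) (Y := Y) (H := H) lab_inj ME trM) => //.
- move=> s s' c c' QQ.
  have ss' : s = s'.
    have [g_inj _ _] := SP _ _ (YS y0 [ffun i => if i == s then c else c'] y0Y).
    apply: g_inj; rewrite !ffunE eqxx; by case: eqP => [->|].
  by split => //; move: QQ; rewrite ss' => /Q_inj.
- rewrite -setI_eq0; apply/eqP/setP => y; rewrite in_setI in_set0; apply/negP => /andP[yY yM].
  have [_ yU _] := SP _ _ (YS y [ffun=> ord0] yY).
  by have /disjointFr/(_ yU) := UM; rewrite yM.
- move=> h /HG hG i j ij.
  have [_ _ GE] := SP _ _ (YS y0 [ffun=> ord0] y0Y).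
  move: hG; rewrite -GE inE => /andP[/injectiveP h_inj _].
  by apply: h_inj; rewrite !ffunE.
- move=> y h g yY /HG hG.
  have [_ _ GE] := SP _ _ (YS y g yY).
  move: hG; rewrite -GE inE => /andP[_].
  congr (is_true (_ |: _ \in E)).
  by apply: eq_imset => i; rewrite ffunE.
Qed.

(** The degree condition is confined to [D] so that absorbers can be set aside by deleting the edges
    that meet them: their vertices become isolated, while the type [V] stays the same. *)
Lemma almost_perfect (R : realType) (r : nat) (eps eta : R) :
  (0 < r)%N -> 0 < eps -> eps <= 1 -> 0 < eta ->
  exists n0 : nat, forall (V : finType) (E : {set {set V}}) (D : {set V}),
    (n0 <= #|V|)%N -> (r.+1 %| #|V|)%N -> (forall e, e \in E -> #|e| = r.+1) ->
    (forall v, v \in D -> (43 / 50 + eps) * #|V|%:R ^+ r <= (tdeg E r v)%:R) ->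
    exists M : {set {set V}}, [/\ M \subset E, trivIset M &
      #|D :\: cover M|%:R <= eta * #|V|%:R].
Proof.
move=> r_gt0 eps_gt0 eps_le1 eta_gt0.
have [p0 enlarge] := dense_uncovered_enlarge r_gt0 eps_gt0 eps_le1 eta_gt0.
exists (p0 * r.+1)%N => V E D V_ge /dvdnP[p cardV] Ek Ddeg.
pose ok (M : {set {set V}}) := (M \subset E) && trivIset M.
have ok0 : ok set0.
  by rewrite /ok sub0set; apply/trivIsetP => A B; rewrite inE.
case: (@arg_maxnP _ set0 ok (fun M => #|M|) ok0) => M /andP[ME trM] M_max.
exists M; split => //; rewrite leNgt; apply/negP => U_gt.
have [||||M' [ME' trM' lt_MM']] := enlarge p V E M (D :\: cover M) _ cardV Ek ME trM.
- by rewrite cardV leq_pmul2r // in V_ge.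
- by rewrite -setI_eq0 setIDAC -setIDA setDv setI0.
- by move=> u; rewrite inE => /andP[_ /Ddeg].
- exact: ltW.
have : ok M' by rewrite /ok ME' trM'.
by move=> /M_max /=; rewrite leqNgt lt_MM'.
Qed.

(** * Absorption *)

(* [pmatchable E S]: [S] is the vertex set of a matching in [E]. *)
Definition pmatchable (V : finType) (E : {set {set V}}) (S : {set V}) : Prop :=
  exists M : {set {set V}}, [/\ M \subset E, trivIset M & cover M = S].

Lemma pmatchable0 (V : finType) (E : {set {set V}}) : pmatchable E set0.
Proof.
exists set0; split; rewrite ?sub0set //; last by rewrite /cover big_set0.
by apply/trivIsetP => A B; rewrite inE.
Qed.

Lemma pmatchableU (V : finType) (E : {set {set V}}) (S S' : {set V}) :
  pmatchable E S -> pmatchable E S' -> [disjoint S & S'] -> pmatchable E (S :|: S').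
Proof.
move=> [M [ME trM <-]] [M' [ME' trM' <-]] MM'.
exists (M :|: M'); split; first by rewrite subUset ME.
  apply/trivIsetP => A B; rewrite !inE.
  have cross A' B' : A' \in M -> B' \in M' -> [disjoint A' & B'].
    move=> AM BM; apply: disjointWl (bigcup_sup A' AM) _.
    by apply: disjointWr (bigcup_sup B' BM) _.
  move=> /orP[AM|AM] /orP[BM|BM] AB.
  - exact: (trivIsetP trM).
  - exact: cross.
  - by rewrite disjoint_sym; apply: cross.
  exact: (trivIsetP trM').
by rewrite /cover bigcup_setU.
Qed.

(** A union of [#|I|] sets of size [k] attains its maximal size only if they are disjoint, so a
    cardinality replaces pairwise checks. *)
Lemma pmatchable_bigcup (V I : finType) (E : {set {set V}}) (k : nat) (f : I -> {set V}) :
  (forall e, e \in E -> #|e| = k) -> (forall i, f i \in E) ->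
  #|\bigcup_i f i| = (#|I| * k)%N -> pmatchable E (\bigcup_i f i).
Proof.
move=> Ek fE card_f; exists (f @: setT).
have covf : cover (f @: setT) = \bigcup_i f i.
  by rewrite cover_imset; apply: eq_bigl => i; rewrite inE.
split => //; first by apply/subsetP => _ /imsetP[i _ ->].
rewrite /trivIset eqn_leq leq_card_cover andbT covf card_f.
rewrite (eq_bigr (fun=> k)) => [|B /imsetP[i _ ->]]; last exact: Ek.
by rewrite sum_nat_const leq_mul2r (leq_trans (leq_imset_card _ _)) ?orbT // cardsT.
Qed.

Lemma disjoint_bigcup (V I : finType) (A : {set V}) (F : {set I}) (g : I -> {set V}) :
  (forall i, i \in F -> [disjoint A & g i]) -> [disjoint A & \bigcup_(i in F) g i].
Proof.
move=> dis; rewrite -setI_eq0; apply/eqP/setP => v; rewrite in_setI in_set0.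
apply/negP => /andP[vA /bigcupP[i iF vi]].
by have /disjointFr/(_ vA) := dis i iF; rewrite vi.
Qed.

Lemma pmatchable_family (V I : finType) (E : {set {set V}}) (F : {set I}) (g : I -> {set V}) :
  (forall i, i \in F -> pmatchable E (g i)) ->
  (forall i j, i \in F -> j \in F -> i != j -> [disjoint g i & g j]) ->
  pmatchable E (\bigcup_(i in F) g i).
Proof.
have [n] := ubnP #|F|; elim: n F => // n IH F lt_Fn gE gd.
have [->|[a aF]] := set_0Vmem F; first by rewrite big_set0; apply: pmatchable0.
rewrite (big_setD1 a aF) /=; apply: pmatchableU; first exact: gE.
  apply: IH => [|i|i j].
  - by rewrite [#|F|](cardsD1 a) aF in lt_Fn.
  - by rewrite inE => /andP[_ /gE].
  - by rewrite !inE => /andP[_ iF] /andP[_ jF]; apply: gd.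
apply: disjoint_bigcup => i; rewrite !inE => /andP[ia iF].
by apply: gd; rewrite // eq_sym.
Qed.

(** * Absorbers of a tuple *)

Definition absorber (V : finType) (r : nat) : finType :=
  ({ffun 'I_r -> V} * {ffun 'I_r -> {ffun 'I_r -> V}})%type.

Definition vset (V : finType) (r : nat) (a : absorber V r) : {set V} :=
  [set a.1 i | i : 'I_r] :|: \bigcup_(j : 'I_r) [set a.2 j i | i : 'I_r].

Definition nbrs (V : finType) (E : {set {set V}}) (r : nat) (v : V) :
    {set {ffun 'I_r -> V}} :=
  [set f : {ffun 'I_r -> V} | v |: [set f i | i : 'I_r] \in E].

Definition target (V : finType) (r : nat) (x : V * {ffun 'I_r -> V}) : {set V} :=
  x.1 |: [set x.2 i | i : 'I_r].

(** For [a = (b, A)] and a target [x_0, x_1, ..., x_r], the edges [x_0 |: b] and [x_j |: A_j] cover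
    target and absorber together, whereas [b_j |: A_j] cover the absorber alone. *)
Definition absorbs (V : finType) (E : {set {set V}}) (r : nat)
    (x : V * {ffun 'I_r -> V}) (a : absorber V r) : bool :=
  (a.1 \in nbrs E r x.1) &&
  [forall j, a.2 j \in nbrs E r (x.2 j) :&: nbrs E r (a.1 j)].

(* Independently of the absorbed set, the edges [b_j |: A_j] match [vset a]. *)
Definition proper_absorber (V : finType) (E : {set {set V}}) (r : nat)
    (a : absorber V r) : bool :=
  (#|vset a| == r * r.+1)%N && [forall j, a.2 j \in nbrs E r (a.1 j)].

Lemma pmatchable_vset (V : finType) (E : {set {set V}}) (r : nat) (a : absorber V r) :
  (forall e, e \in E -> #|e| = r.+1) -> proper_absorber E a -> pmatchable E (vset a).
Proof.
move=> Ek /andP[/eqP card_a /forallP aE].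
have vE : vset a = \bigcup_(j : 'I_r) (a.1 j |: [set a.2 j i | i : 'I_r]).
  rewrite big_split /= /vset; congr (_ :|: _).
  apply/setP => v; apply/imsetP/bigcupP => [[i _ ->]|[i _]]; first by exists i; rewrite ?inE.
  by rewrite inE => /eqP ->; exists i.
rewrite vE; apply: (pmatchable_bigcup Ek) => [j|]; first by have := aE j; rewrite inE.
by rewrite -vE card_a card_ord.
Qed.

Lemma pmatchable_absorb (V : finType) (E : {set {set V}}) (r : nat) (a : absorber V r) x :
  (forall e, e \in E -> #|e| = r.+1) -> proper_absorber E a ->
  absorbs E x a -> #|target x| = r.+1 -> [disjoint target x & vset a] ->
  pmatchable E (target x :|: vset a).
Proof.
move=> Ek /andP[/eqP card_a _] /andP[a1 /forallP a2] card_x xa.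
pose f (o : option 'I_r) := if o is Some j then x.2 j |: [set a.2 j i | i : 'I_r]
  else x.1 |: [set a.1 i | i : 'I_r].
have vE : target x :|: vset a = \bigcup_o f o.
  apply/setP => v; apply/idP/bigcupP => [|[[j|] _]].
  - rewrite !inE => /orP[/predU1P[->|/imsetP[j _ ->]]|/orP[va|/bigcupP[j _ va]]].
    + by exists None; rewrite // !inE eqxx.
    + by exists (Some j); rewrite // !inE eqxx.
    + by exists None; rewrite // !inE va orbT.
    + by exists (Some j); rewrite // !inE va orbT.
  - rewrite !inE => /predU1P[->|va]; first by rewrite imset_f ?orbT.
    by apply/orP; right; apply/orP; right; apply/bigcupP; exists j.
  by rewrite !inE => /predU1P[->|->]; rewrite ?eqxx ?orbT.
rewrite vE; apply: (pmatchable_bigcup Ek) => [[j|]|].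
- by have := a2 j; rewrite !inE => /andP[].
- by have := a1; rewrite inE.
rewrite -vE cardsU disjoint_setI0 // cards0 subn0 card_a card_x card_option card_ord.
by rewrite mulSn.
Qed.

Lemma exists_target (V : finType) (r : nat) (S : {set V}) : (r.+1 <= #|S|)%N ->
  exists x : V * {ffun 'I_r -> V}, target x \subset S /\ #|target x| = r.+1.
Proof.
move=> S_ge; have /card_gt0P[v0 _] : (0 < #|S|)%N by apply: leq_trans S_ge.
pose e (i : 'I_r.+1) := nth v0 (enum S) i.
have lt_S (i : 'I_r.+1) : (i < size (enum S))%N by rewrite -cardE (leq_trans (ltn_ord i)).
have e_inj : injective e.
  by move=> i j /eqP; rewrite /e nth_uniq ?enum_uniq // => /eqP/val_inj.
pose x := (e ord0, [ffun i => e (lift ord0 i)]) : V * {ffun 'I_r -> V}.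
have xE : target x = [set e i | i : 'I_r.+1].
  apply/setP => v; rewrite !inE; apply/idP/imsetP => [/predU1P[->|/imsetP[i _ ->]]|[i _ ->]].
  - by exists ord0.
  - by rewrite ffunE; exists (lift ord0 i).
  case: (unliftP ord0 i) => [j ->|->]; last by rewrite eqxx.
  by apply/orP; right; apply/imsetP; exists j; rewrite // ffunE.
exists x; split; last by rewrite xE card_imset // card_ord.
by rewrite xE; apply/subsetP => _ /imsetP[i _ ->]; rewrite -mem_enum mem_nth.
Qed.

(** Each step spends one absorber on [r + 1] vertices of [S], which lowers the supply for every
    other tuple by at most one. The absorbers left at the end match themselves. *)
Lemma absorb_all (V : finType) (E : {set {set V}}) (r : nat)
    (F : {set absorber V r}) (l : nat) (S : {set V}) :
  (forall e, e \in E -> #|e| = r.+1) ->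
  (forall a, a \in F -> proper_absorber E a) ->
  (forall a a', a \in F -> a' \in F -> a != a' -> [disjoint vset a & vset a']) ->
  #|S| = (l * r.+1)%N -> [disjoint S & \bigcup_(a in F) vset a] ->
  (forall x, (l <= #|[set a in F | absorbs E x a]|)%N) ->
  pmatchable E (S :|: \bigcup_(a in F) vset a).
Proof.
move=> Ek; elim: l F S => [|l IH] F S Fp Fd cardS SF Fabs.
  have -> : S = set0 by apply/eqP; rewrite -cards_eq0 cardS.
  by rewrite set0U; apply: pmatchable_family => // a /Fp; apply: pmatchable_vset.
have [|x [xS card_x]] := @exists_target V r S; first by rewrite cardS mulSn leq_addr.
have [a] : exists a, a \in [set a in F | absorbs E x a].
  by apply/set0Pn; rewrite -card_gt0; apply: leq_trans (Fabs x).
rewrite inE => /andP[aF xa].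
have x_vset : [disjoint target x & vset a].
  apply: disjointWl xS _; apply: disjointWr SF.
  exact: (bigcup_sup a).
have DF : {subset F :\ a <= F} by move=> b; rewrite inE => /andP[].
have -> : S :|: \bigcup_(b in F) vset b =
    (target x :|: vset a) :|: ((S :\: target x) :|: \bigcup_(b in F :\ a) vset b).
  rewrite (big_setD1 a aF) /= -{1}(setID S (target x)) (setIidPr xS).
  by rewrite setUACA.
apply: pmatchableU; first by apply: pmatchable_absorb => //; apply: Fp.
  apply: IH => [b /DF/Fp //|b b' /DF bF /DF b'F||| y]; first exact: Fd.
  - by rewrite cardsD (setIidPr xS) cardS card_x mulSn addKn.
  - apply: disjointWl (subsetDl _ _) _; apply: disjoint_bigcup => b /DF bF.
    by apply: disjointWr SF; apply: (bigcup_sup b).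
  have := Fabs y; rewrite (cardsD1 a) => le_l.
  have : (l <= #|[set b in F | absorbs E y b] :\ a|)%N by case: (a \in _) le_l; lia.
  move=> /leq_trans; apply; apply: subset_leq_card; apply/subsetP => b.
  by rewrite !inE => /and3P[-> -> ->].
have a_other : [disjoint vset a & \bigcup_(b in F :\ a) vset b].
  apply: disjoint_bigcup => b; rewrite !inE => /andP[ba bF].
  by apply: Fd; rewrite // eq_sym.
have x_other : [disjoint target x & \bigcup_(b in F :\ a) vset b].
  apply: disjointWl xS _; apply: disjoint_bigcup => b /DF bF.
  by apply: disjointWr SF; apply: (bigcup_sup b).
have a_S : [disjoint vset a & S].
  by rewrite disjoint_sym; apply: disjointWr SF; apply: (bigcup_sup a).
rewrite -setI_eq0; apply/eqP/setP => v; rewrite in_setI in_set0.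
apply/negP => /andP[/setUP[vx|va] /setUP[/setDP[vS vx']|v_other]].
- by rewrite vx in vx'.
- by rewrite (disjointFr x_other vx) in v_other.
- by rewrite (disjointFr a_S va) in vS.
by rewrite (disjointFr a_other va) in v_other.
Qed.

(* Derandomised choice: each new element is chosen so as to decrease the
   potential [sum_x 2^-(number of chosen elements related to x)] as much as a
   random one does on average. *)
Lemma greedy_family (R : realFieldType) (V X W : finType) (vs : W -> {set V})
    (ok : pred W) (ab : X -> W -> bool) (c : R) (K f : nat) :
  0 < c -> (0 < K)%N -> (0 < #|X|)%N -> (0 < #|W|)%N ->
  (forall a, ok a -> #|vs a| = K) ->
  (forall Z : {set V}, (#|Z| <= K * f)%N -> forall x,
     c * #|W|%:R <= #|[set a | [&& ok a, [disjoint vs a & Z] & ab x a]]|%:R) ->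
  exists F : {set W}, [/\ #|F| = f, forall a, a \in F -> ok a,
    forall a a', a \in F -> a' \in F -> a != a' -> [disjoint vs a & vs a'] &
    \sum_x (1 / 2) ^+ #|[set a in F | ab x a]| <= (1 - c / 2) ^+ f * #|X|%:R].
Proof.
move=> c_gt0 K_gt0 X_gt0 W_gt0 card_vs many.
suff step j : (j <= f)%N -> exists F : {set W}, [/\ #|F| = j, forall a, a \in F -> ok a,
    forall a a', a \in F -> a' \in F -> a != a' -> [disjoint vs a & vs a'] &
    \sum_x (1 / 2) ^+ #|[set a in F | ab x a]| <= (1 - c / 2) ^+ j * #|X|%:R].
  exact: step.
elim: j => [_|j IH lt_jf].
  exists set0; split; rewrite ?cards0 //; try by move=> a; rewrite inE.
  rewrite expr0 [leRHS]mul1r (eq_bigr (fun=> 1)) ?sumr_const // => x _.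
  by rewrite (_ : [set a in _ | _] = set0) ?cards0 //; apply/setP => a; rewrite !inE.
have [F [card_F F_ok F_dis F_pot]] := IH (ltnW lt_jf).
pose Z := \bigcup_(a in F) vs a.
have Z_le : (#|Z| <= K * f)%N.
  apply: leq_trans (_ : \sum_(a in F) #|vs a| <= _)%N.
    rewrite /Z; elim/big_rec2: _ => [|a n A _ le_An]; first by rewrite cards0.
    by apply: leq_trans (leq_card_setU _ _) _; rewrite leq_add2l.
  rewrite (eq_bigr (fun=> K)) => [|a /F_ok/card_vs //].
  by rewrite sum_nat_const card_F mulnC leq_mul2l (ltnW lt_jf) orbT.
pose Al := [set a | ok a && [disjoint vs a & Z]].
pose phi x : R := (1 / 2) ^+ #|[set a in F | ab x a]|.
have phi_ge0 x : 0 <= phi x by rewrite exprn_ge0 // divr_ge0.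
have Al_ge x : c * #|W|%:R <= #|[set a in Al | ab x a]|%:R.
  apply: le_trans (many Z Z_le x) _; rewrite ler_nat; apply: subset_leq_card.
  by apply/subsetP => a; rewrite !inE => /and3P[-> ->].
have cW_gt0 : 0 < c * #|W|%:R by rewrite mulr_gt0 // ltr0n.
have Al_gt0 : 0 < #|Al|%:R :> R.
  have /card_gt0P[x _] := X_gt0.
  apply: lt_le_trans cW_gt0 (le_trans (Al_ge x) _); rewrite ler_nat.
  by apply: subset_leq_card; apply/subsetP => a; rewrite inE => /andP[].
have Al_le : #|Al|%:R <= #|W|%:R :> R by rewrite ler_nat max_card.
pose psi a := \sum_x phi x * (if ab x a then 1 / 2 else 1).
have [a aAl psi_le] : exists2 a, a \in Al & psi a <= (1 - c / 2) * \sum_x phi x.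
  apply/exists_inP; apply: contraT => /exists_inPn psi_gt.
  have : \sum_(a in Al) psi a <= #|Al|%:R * ((1 - c / 2) * \sum_x phi x).
    rewrite /psi exchange_big /= mulrA big_distrr /=; apply: ler_sum => x _.
    rewrite -big_distrr /= mulrC ler_wpM2r //.
    have -> : \sum_(a in Al) (if ab x a then 1 / 2 else 1) =
        #|Al|%:R - 1 / 2 * #|[set a in Al | ab x a]|%:R :> R.
      rewrite -sum1dep_card natr_sum big_distrr /= -sum1_card natr_sum.
      rewrite [in X in _ = _ - X]big_mkcondr /= -sumrB.
      by apply: eq_bigr => a _; case: ifP => _; [field|ring].
    by have := Al_ge x; have := ler_wpM2l (ltW c_gt0) Al_le; lra.
  rewrite leNgt => /negP; case.
  rewrite mulr_natl -sumr_const; apply: ltr_sum.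
    have : (0 < #|Al|)%N by rewrite -(ltr0n R).
    move=> /card_gt0P[a aAl]; apply/hasP; exists a => //.
  by move=> a /psi_gt; rewrite -ltNge.
have aF : a \notin F.
  apply/negP => aF; move: aAl; rewrite inE => /andP[/card_vs va].
  rewrite disjoint_sym => /(disjointWl (bigcup_sup a aF)).
  by rewrite -setI_eq0 setIid -cards_eq0 va; case: (K) K_gt0.
exists (a |: F); split.
- by rewrite cardsU1 aF card_F.
- by move=> b /setU1P[->|/F_ok //]; move: aAl; rewrite inE => /andP[].
- have a_dis b : b \in F -> [disjoint vs a & vs b].
    move=> bF; move: aAl; rewrite inE => /andP[_]; apply: disjointWr.
    exact: (bigcup_sup b).
  move=> b b' /setU1P[->|bF] /setU1P[->|b'F] bb'; first by rewrite eqxx in bb'.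
  + exact: a_dis.
  + by rewrite disjoint_sym; apply: a_dis.
  exact: F_dis.
have -> : \sum_x (1 / 2) ^+ #|[set b in a |: F | ab x b]| = psi a.
  apply: eq_bigr => x _; rewrite /phi; case: ifP => xa.
    rewrite (_ : [set b in a |: F | ab x b] = a |: [set b in F | ab x b]).
      by rewrite cardsU1 inE (negbTE aF) /= add1n exprSr.
    by apply/setP => b; rewrite !inE; case: eqP => [->|] //=; rewrite xa.
  rewrite mulr1 (_ : [set b in a |: F | ab x b] = [set b in F | ab x b]) //.
  by apply/setP => b; rewrite !inE; case: eqP => [->|] //=; rewrite xa !andbF.
apply: le_trans psi_le _.
have c_le1 : c <= 1.
  have W_gt0R : 0 < #|W|%:R :> R by rewrite ltr0n.
  have /card_gt0P[x _] := X_gt0.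
  rewrite -(ler_pM2r W_gt0R) mul1r; apply: le_trans (Al_ge x) _.
  by rewrite ler_nat max_card.
rewrite exprS -mulrA ler_wpM2l //; lra.
Qed.

(** * Counting absorbers *)

Lemma card_setI_ge (T : finType) (A B : {set T}) : (#|A| + #|B| <= #|A :&: B| + #|T|)%N.
Proof. by rewrite -cardsUI addnC leq_add2l max_card. Qed.

Lemma card_absorber (V : finType) (r : nat) : #|absorber V r| = (#|V| ^ (r * r.+1))%N.
Proof. by rewrite card_prod !card_ffun !card_ord -expnM -expnD mulnS. Qed.

Lemma card_proper_avoiding (V : finType) (r : nat) (Z : {set V}) :
  ((#|V| - #|Z|) ^_ (r * r.+1) <=
   #|[set a : absorber V r | (#|vset a| == r * r.+1)%N && [disjoint vset a & Z]]|)%N.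
Proof.
pose I := ('I_r + 'I_r * 'I_r)%type.
pose dec (f : {ffun I -> V}) : absorber V r :=
  ([ffun i => f (inl i)], [ffun j => [ffun i => f (inr (j, i))]]).
have dec_inj : injective dec.
  move=> f g [/ffunP fg1 /ffunP fg2]; apply/ffunP => -[i|[j i]].
    by have := fg1 i; rewrite !ffunE.
  by have := fg2 j; rewrite !ffunE => /ffunP/(_ i); rewrite !ffunE.
have vsetE f : vset (dec f) = [set f i | i : I].
  apply/setP => v; apply/setUP/imsetP
    => [[/imsetP[i _ ->]|/bigcupP[j _ /imsetP[i _ ->]]]|[[i|[j i]] _ ->]].
  - by rewrite ffunE; exists (inl i).
  - by rewrite !ffunE; exists (inr (j, i)).
  - by left; apply/imsetP; exists i; rewrite ?ffunE.
  by right; apply/bigcupP; exists j => //; apply/imsetP; exists i; rewrite ?ffunE.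
have cardI : #|{: I}| = (r * r.+1)%N by rewrite card_sum card_prod !card_ord mulnS.
have cardZ : #|~: Z| = (#|V| - #|Z|)%N by rewrite cardsCs setCK.
rewrite -cardZ -cardI -(card_inj_ffuns_on I (mem (~: Z))) -(card_imset _ dec_inj).
apply: subset_leq_card; apply/subsetP => _ /imsetP[f + ->].
rewrite !inE vsetE => /andP[/ffun_onP fZ /injectiveP f_inj].
rewrite card_imset // cardI eqxx /= -setI_eq0; apply/eqP/setP => v.
rewrite in_setI in_set0; apply/negP => /andP[/imsetP[i _ ->]].
by apply/negP; have := fZ i; rewrite inE.
Qed.

(** Two neighbourhoods of density [4/5] share at least [3/5], rounded down to [1/2]. Choosing [b]
    and then the [r] tuples [A_j] gives [r + 1] such factors. *)
Lemma card_absorbs (R : realType) (V : finType) (E : {set {set V}}) (r : nat)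
    (x : V * {ffun 'I_r -> V}) :
  (forall v, 4 / 5 * #|V|%:R ^+ r <= (tdeg E r v)%:R :> R) ->
  (1 / 2) ^+ r.+1 * #|absorber V r|%:R <= #|[set a : absorber V r | absorbs E x a]|%:R :> R.
Proof.
move=> deg_ge; have V_ge0 : 0 <= #|V|%:R ^+ r :> R by rewrite exprn_ge0.
have nI v w : 1 / 2 * #|V|%:R ^+ r <= #|nbrs E r v :&: nbrs E r w|%:R :> R.
  have := card_setI_ge (nbrs E r v) (nbrs E r w).
  rewrite -(ler_nat R) !natrD card_ffun card_ord natrX.
  by have := deg_ge v; have := deg_ge w; rewrite /tdeg -!/(nbrs _ _ _); lra.
set Ab := [set a : absorber V r | absorbs E x a].
rewrite natr_card (eq_bigr (fun a => ((a.1, a.2) \in Ab)%:R)); last by case.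
rewrite -(pair_bigA _ (fun b A => ((b, A) \in Ab)%:R)) /=.
apply: (@le_trans _ _ (\sum_(b in nbrs E r x.1) \prod_(j < r) (1 / 2 * #|V|%:R ^+ r))).
  rewrite prodr_const card_ord sumr_const -[leRHS]mulr_natl card_absorber.
  rewrite mulnS expnD natrM !natrX exprM.
  set n := #|V|%:R ^+ r in V_ge0 *.
  rewrite [(1 / 2 * n) ^+ r]exprMn [(1 / 2) ^+ r.+1]exprS mulrACA.
  have h_ge0 : 0 <= (1 / 2) ^+ r * n ^+ r :> R by rewrite mulr_ge0 ?exprn_ge0 ?divr_ge0.
  rewrite ler_wpM2r //.
  by have := deg_ge x.1; rewrite -/n; move: V_ge0; rewrite /tdeg -/(nbrs _ _ _); lra.
rewrite [leRHS](bigID (mem (nbrs E r x.1))) /= ler_wpDr //.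
  by apply: sumr_ge0 => b _; apply: sumr_ge0.
apply: ler_sum => b xb.
have -> : \sum_A ((b, A) \in Ab)%:R =
    #|family (fun j => mem (nbrs E r (x.2 j) :&: nbrs E r (b j)))|%:R :> R.
  rewrite natr_card; apply: eq_bigr => A _; rewrite inE /absorbs /= xb /=.
  by congr (_ : bool)%:R; apply/forallP/familyP.
rewrite card_family foldrE big_map big_enum /= natr_prod.
apply: ler_prod => j _; rewrite nI andbT.
by rewrite mulr_ge0 // divr_ge0.
Qed.

Lemma card_absorbs_avoiding (R : realType) (V : finType) (E : {set {set V}}) (r : nat)
    (Z : {set V}) (x : V * {ffun 'I_r -> V}) (c : R) :
  (forall v, 4 / 5 * #|V|%:R ^+ r <= (tdeg E r v)%:R :> R) ->
  (1 - c) * #|V|%:R ^+ (r * r.+1) <= ((#|V| - #|Z|) ^_ (r * r.+1))%:R ->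
  ((1 / 2) ^+ r.+1 - c) * #|absorber V r|%:R <=
  #|[set a : absorber V r | [&& proper_absorber E a, [disjoint vset a & Z] & absorbs E x a]]|%:R.
Proof.
move=> deg_ge ffact_ge_c.
set A := [set a : absorber V r | (#|vset a| == r * r.+1)%N && [disjoint vset a & Z]].
set B := [set a : absorber V r | absorbs E x a].
set C := [set a : absorber V r | [&& _, _ & _]].
have : (#|A :&: B| <= #|C|)%N.
  apply: subset_leq_card; apply/subsetP => a; rewrite !inE /proper_absorber.
  move=> /andP[/andP[-> ->] xa]; rewrite xa /= !andbT.
  by move: xa => /andP[_ /forallP aE]; apply/forallP => j; have := aE j; rewrite inE => /andP[].
have := card_setI_ge A B; have := card_absorbs x deg_ge; have := card_proper_avoiding r Z.
rewrite -/A -/B -!(ler_nat R) !natrD.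
move: ffact_ge_c; rewrite -natrX -card_absorber; lra.
Qed.

(** * Choice of constants and the perfect matching *)

Lemma pow_lt_exp2 (g k : nat) : (0 < g)%N ->
  exists n0 : nat, forall n, (n0 <= n)%N -> (n ^ k < 2 ^ (n %/ g))%N.
Proof.
move=> g_gt0; pose G := (g * k.+1)%N.
have G_gt0 : (0 < G)%N by rewrite muln_gt0 g_gt0.
exists ((2 * G) ^ k.+1 + G)%N => n n_ge.
(* With this [j], [n ^ k <= j ^ k.+1 < 2 ^ (j * k.+1)]: the spare factor [j] absorbs the constant
   [(2 * G) ^ k.+1]. *)
pose j := (n %/ G)%N.
have j_gt0 : (0 < j)%N by rewrite divn_gt0 //; lia.
have n_le : (n <= 2 * G * j)%N.
  have := ltn_ceil n G_gt0; rewrite -/j mulSn.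
  by have := leq_pmulr G j_gt0; lia.
apply: (@leq_ltn_trans (j ^ k.+1)).
  have G2_gt0 : (0 < (2 * G) ^ k.+1)%N by rewrite expn_gt0 muln_gt0 G_gt0.
  rewrite -(leq_pmul2l G2_gt0) -expnMn.
  apply: leq_trans (_ : n ^ k.+1 <= _)%N; last first.
    by rewrite leq_exp2r.
  by rewrite [in leqRHS]expnS leq_mul2r; apply/orP; right; lia.
apply: (@leq_trans ((2 ^ j) ^ k.+1)); first by rewrite ltn_exp2r // ltn_expl.
rewrite -expnM leq_exp2l //.
by rewrite /j /G leq_divRL // -mulnA [(k.+1 * g)%N]mulnC leq_trunc_div.
Qed.

Lemma bernoulli_le (R : realFieldType) (x : R) (n : nat) : 0 <= x <= 1 ->
  1 - n%:R * x <= (1 - x) ^+ n.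
Proof.
move=> /andP[x_ge0 x_le1]; elim: n => [|n IH]; first by rewrite mul0r subr0.
have y_ge0 : 0 <= 1 - x by rewrite subr_ge0.
rewrite exprS; apply: le_trans (ler_wpM2l y_ge0 IH).
have : 0 <= n%:R * x ^+ 2 by rewrite mulr_ge0 ?exprn_ge0.
by rewrite -natr1; lra.
Qed.

Lemma exists_small_power (R : realType) (x : R) : 0 < x -> x <= 1 ->
  exists n : nat, (0 < n)%N /\ (1 - x) ^+ n <= 1 / 4.
Proof.
move=> x_gt0 x_le1.
have pow n : (1 - x) ^+ n * (1 + n%:R * x) <= 1.
  elim: n => [|n IH]; first by rewrite mul0r addr0 mulr1.
  apply: le_trans IH; rewrite exprSr -mulrA ler_wpM2l ?exprn_ge0 ?subr_ge0 //.
  have : 0 <= n%:R * x ^+ 2 by rewrite mulr_ge0 ?exprn_ge0 // ltW.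
  by rewrite -natr1; have := sqr_ge0 x; lra.
have [n n_ge] := exists_nat_ge (3 / x); exists n.+1; split => //.
have n_ge' : 3 <= n.+1%:R * x.
  rewrite -ler_pdivrMr //; apply: le_trans n_ge _.
  by rewrite ler_nat.
have y_ge0 : 0 <= (1 - x) ^+ n.+1 by rewrite exprn_ge0 // subr_ge0.
have := pow n.+1; have := ler_wpM2l y_ge0 n_ge'.
rewrite mulrDr mulr1; lra.
Qed.

Lemma ffact_sub_asymp (R : realType) (K : nat) (d : R) : 0 < d ->
  exists g0 : nat, forall g, (g0 <= g)%N -> exists n0 : nat, forall n z,
    (n0 <= n)%N -> (z * g <= n)%N -> (1 - d) * n%:R ^+ K <= ((n - z) ^_ K)%:R.
Proof.
move=> d_gt0.
have d2_gt0 : 0 < d / 2 by rewrite divr_gt0.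
have [n1 n1_ge] := ffact_asymp K d2_gt0.
have [g1 g1_ge] := exists_nat_ge (K%:R / (d / 2)).
exists (maxn 2 g1) => g; rewrite geq_max => /andP[g_ge2 g_ge1].
have g_gt0 : 0 < g%:R :> R by rewrite ltr0n; lia.
exists (2 * n1)%N => n z n_ge zg_le.
have z_le : (2 * z <= n)%N by apply: leq_trans zg_le; rewrite mulnC leq_mul2l g_ge2 orbT.
have nz_ge : (n1 <= n - z)%N by lia.
have [d_ge|d_lt] := leP 1 (d / 2).
  by apply: (@le_trans _ _ 0) => //; rewrite mulr_le0_ge0 ?exprn_ge0 //; lra.
apply: le_trans (n1_ge _ nz_ge).
have x_in : 0 <= (g%:R^-1 : R) <= 1.
  by rewrite invr_ge0 (ltW g_gt0) invf_le1 // ler1n; lia.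
have bern : 1 - d / 2 <= (1 - g%:R^-1) ^+ K :> R.
  apply: le_trans (@bernoulli_le _ _ K x_in); rewrite lerD2l lerN2.
  rewrite ler_pdivrMr // mulrC -ler_pdivrMr //; apply: le_trans g1_ge _.
  by rewrite ler_nat.
have nz : (1 - g%:R^-1) * n%:R <= (n - z)%:R :> R.
  rewrite natrB; last by lia.
  rewrite mulrBl mul1r lerD2l lerN2 mulrC ler_pdivlMr // -natrM ler_nat //.
have nzK : ((1 - g%:R^-1) * n%:R) ^+ K <= (n - z)%:R ^+ K :> R.
  rewrite lerXn2r ?nnegrE // mulr_ge0 // subr_ge0.
  by case/andP: x_in.
apply: (@le_trans _ _ ((1 - d / 2) * ((1 - d / 2) * n%:R ^+ K))).
  rewrite mulrA ler_wpM2r ?exprn_ge0 //.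
  by have := sqr_ge0 d; lra.
rewrite ler_wpM2l //; first by lra.
apply: le_trans nzK; rewrite exprMn ler_wpM2r ?exprn_ge0 //.
Qed.

Lemma tdeg_avoiding (V : finType) (E : {set {set V}}) (r : nat) (Z : {set V}) v :
  v \notin Z ->
  (tdeg E r v + (#|V| - #|Z|) ^ r <=
   tdeg [set e in E | [disjoint e & Z]] r v + #|V| ^ r)%N.
Proof.
move=> vZ.
pose A := [set f : {ffun 'I_r -> V} | f \in ffun_on (mem (~: Z))].
have cardA : #|A| = ((#|V| - #|Z|) ^ r)%N.
  have cardZ : #|~: Z| = (#|V| - #|Z|)%N by rewrite cardsCs setCK.
  by rewrite cardsE card_ffun_on card_ord -cardZ.
have := card_setI_ge (nbrs E r v) A.
rewrite cardA card_ffun card_ord => /leq_trans; apply; rewrite leq_add2r.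
apply: subset_leq_card; apply/subsetP => f; rewrite !inE => /andP[-> /ffun_onP fZ] /=.
rewrite -setI_eq0; apply/eqP/setP => u; rewrite in_setI in_set0; apply/negP.
move=> /andP[/setU1P[->|/imsetP[i _ ->]] uZ]; first by rewrite uZ in vZ.
by have := fZ i; rewrite !inE uZ.
Qed.

Lemma pmatchable_dvdn (V : finType) (E : {set {set V}}) (k : nat) (S : {set V}) :
  (forall e, e \in E -> #|e| = k) -> pmatchable E S -> (k %| #|S|)%N.
Proof.
move=> Ek [M [ME trM <-]]; rewrite -(eqP trM) (eq_bigr (fun=> k)).
  by rewrite sum_nat_const dvdn_mull.
by move=> e eM; apply: Ek; apply: (subsetP ME).
Qed.

Lemma tuple_perfect_matching (R : realType) (r : nat) (eps : R) :
  (0 < r)%N -> 0 < eps -> eps <= 1 ->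
  exists n0 : nat, forall (V : finType) (E : {set {set V}}),
    (n0 <= #|V|)%N -> (r.+1 %| #|V|)%N -> (forall e, e \in E -> #|e| = r.+1) ->
    (forall v, (43 / 50 + eps) * #|V|%:R ^+ r <= (tdeg E r v)%:R) ->
    pmatchable E [set: V].
Proof.
move=> r_gt0 eps_gt0 eps_le1.
pose c : R := (1 / 2) ^+ r.+1 / 2.
have h_gt0 : 0 < (1 / 2) ^+ r.+1 :> R by rewrite exprn_gt0 // divr_gt0.
have h_le1 : (1 / 2) ^+ r.+1 <= 1 :> R by rewrite exprn_ile1 //; lra.
have c_gt0 : 0 < c by rewrite divr_gt0.
have c2_gt0 : 0 < c / 2 by rewrite divr_gt0.
have c2_le1 : c / 2 <= 1 by rewrite /c; lra.
pose K := (r * r.+1)%N.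
have K_gt0 : (0 < K)%N by rewrite muln_gt0 r_gt0.
have [g0 sub_asymp] := ffact_sub_asymp K c_gt0.
have [g1 g1_ge] := exists_nat_ge (r%:R / (eps / 2)).
pose g := maxn 2 (maxn g0 g1).
have g_gt0 : 0 < g%:R :> R by rewrite ltr0n leq_max.
have [n1 n1_ge] : exists n1 : nat, forall n z, (n1 <= n)%N -> (z * g <= n)%N ->
    (1 - c) * n%:R ^+ K <= ((n - z) ^_ K)%:R.
  by apply: sub_asymp; rewrite !leq_max leqnn orbT.
have [D [D_gt0 D_le]] := exists_small_power c2_gt0 c2_le1.
(* With [L = n %/ G] and [f = D * L] absorbers of [K] vertices each, at most [n / g] vertices are
   set aside, while [D] rounds of choice divide the potential by at least 4. *)
pose G := (K * D * g)%N.
have G_gt0 : (0 < G)%N by rewrite /G muln_gt0 [X in X && _]muln_gt0 K_gt0 D_gt0 -(ltr0n R).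
have [n2 n2_ge] := pow_lt_exp2 r.+1 G_gt0.
have eps2_gt0 : 0 < eps / 2 by rewrite divr_gt0.
have eps2_le1 : eps / 2 <= 1 by lra.
pose eta : R := (2 * G)%:R^-1.
have G2_gt0 : 0 < (2 * G)%:R :> R by rewrite ltr0n muln_gt0 G_gt0.
have eta_gt0 : 0 < eta by rewrite invr_gt0.
have [n3 n3_ge] := almost_perfect r_gt0 eps2_gt0 eps2_le1 eta_gt0.
exists (maxn 1 (maxn n1 (maxn n2 (maxn n3 (2 * G)))))%N => V E.
rewrite !geq_max => /and5P[V_gt0 n1_le n2_le n3_le G_le] V_dvd Ek Edeg.
pose n := #|V|; pose L := (n %/ G)%N; pose f := (D * L)%N.
have nr_ge0 : 0 <= n%:R ^+ r :> R by rewrite exprn_ge0.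
have Kf_le : (K * f * g <= n)%N.
  by rewrite /f mulnA mulnAC -/G mulnC leq_trunc_div.
have L_gt0 : (0 < L)%N by rewrite divn_gt0 // (leq_trans _ G_le) // leq_pmull.
have deg_ge v : 4 / 5 * #|V|%:R ^+ r <= (tdeg E r v)%:R :> R.
  apply: le_trans (Edeg v); rewrite ler_wpM2r //; lra.
have X_gt0 : (0 < #|{: V * {ffun 'I_r -> V}}|)%N.
  by rewrite card_prod card_ffun muln_gt0 expn_gt0 V_gt0.
have W_gt0 : (0 < #|absorber V r|)%N by rewrite card_absorber expn_gt0 V_gt0.
have [||F [card_F F_ok F_dis F_pot]] := @greedy_family R V
    (V * {ffun 'I_r -> V})%type (absorber V r) (fun a => vset a)
    (fun a => proper_absorber E a) (fun x a => absorbs E x a) c K f c_gt0 K_gt0 X_gt0 W_gt0.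
- by move=> a /andP[/eqP].
- move=> Z Z_le x.
  have -> : c = (1 / 2) ^+ r.+1 - c by rewrite /c; lra.
  apply: card_absorbs_avoiding => //; apply: n1_ge => //.
  by apply: leq_trans Kf_le; rewrite leq_mul2r Z_le orbT.
(* A tuple with fewer than [L] absorbers would alone contribute at least [2^-L], but the whole
   potential is at most [4^-L * n ^ r.+1], and [n ^ r.+1 < 2 ^ L]. *)
have F_abs x : (L <= #|[set a in F | absorbs E x a]|)%N.
  rewrite leqNgt; apply/negP => lt_L.
  have pot_ge : (1 / 2) ^+ L <= (1 - c / 2) ^+ f * (n ^ r.+1)%:R :> R.
    have -> : (n ^ r.+1)%N = #|{: V * {ffun 'I_r -> V}}|.
      by rewrite card_prod card_ffun card_ord expnS.
    apply: le_trans F_pot; rewrite (bigD1 x) //=.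
    apply: (@le_trans _ _ ((1 / 2) ^+ #|[set a in F | absorbs E x a]|)).
      by rewrite ler_wiXn2l ?(ltnW lt_L) //; lra.
    by rewrite lerDl sumr_ge0 // => y _; rewrite exprn_ge0 // divr_ge0.
  have : (1 - c / 2) ^+ f <= (1 / 4) ^+ L.
    by rewrite /f exprM lerXn2r ?nnegrE ?exprn_ge0 ?divr_ge0 // subr_ge0.
  move=> /(ler_wpM2r (ler0n R (n ^ r.+1))) /(le_trans pot_ge).
  have -> : (1 / 4) ^+ L = (1 / 2) ^+ L * (1 / 2) ^+ L :> R.
    by rewrite -exprMn; congr (_ ^+ _); field.
  have half_gt0 : 0 < (1 / 2) ^+ L :> R by rewrite exprn_gt0 // divr_gt0.
  rewrite -[leRHS]mulrA -[leLHS]mulr1 ler_pM2l //.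
  have two : 2 ^+ L * (1 / 2) ^+ L = 1 :> R.
    by rewrite -exprMn (_ : 2 * (1 / 2) = 1) ?expr1n //; field.
  move=> /(ler_wpM2l (exprn_ge0 L (ler0n R 2))).
  rewrite mulr1 mulrA two mul1r -natrX ler_nat leqNgt.
  by have := n2_ge n n2_le; rewrite -/L => ->.
pose Z := \bigcup_(a in F) vset a.
have Z_le : (#|Z| <= K * f)%N.
  apply: leq_trans (_ : \sum_(a in F) #|vset a| <= _)%N.
    rewrite /Z; elim/big_rec2: _ => [|a m A _ le_Am]; first by rewrite cards0.
    by apply: leq_trans (leq_card_setU _ _) _; rewrite leq_add2l.
  rewrite (eq_bigr (fun=> K)) => [|a /F_ok/andP[/eqP ->] //].
  by rewrite sum_nat_const card_F mulnC.
have Z_dvd : (r.+1 %| #|Z|)%N.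
  apply: (pmatchable_dvdn Ek); apply: pmatchable_family => // a /F_ok.
  exact: pmatchable_vset.
pose E' := [set e in E | [disjoint e & Z]].
have E'k e : e \in E' -> #|e| = r.+1 by rewrite inE => /andP[/Ek].
have E'deg v : v \in ~: Z -> (43 / 50 + eps / 2) * #|V|%:R ^+ r <= (tdeg E' r v)%:R.
  rewrite inE => vZ; have := tdeg_avoiding E r vZ; rewrite -/E'.
  rewrite -(ler_nat R) !natrD !natrX.
  have x_in : 0 <= (g%:R^-1 : R) <= 1.
    by rewrite invr_ge0 (ltW g_gt0) invf_le1 // ler1n -(ltr0n R).
  have bern : 1 - eps / 2 <= (1 - g%:R^-1) ^+ r :> R.
    apply: le_trans (@bernoulli_le _ _ r x_in); rewrite lerD2l lerN2.
    rewrite ler_pdivrMr // mulrC -ler_pdivrMr //; apply: le_trans g1_ge _.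
    by rewrite ler_nat !leq_max leqnn !orbT.
  have nz : (1 - g%:R^-1) * n%:R <= (n - #|Z|)%:R :> R.
    rewrite natrB ?max_card // mulrBl mul1r lerD2l lerN2 mulrC ler_pdivlMr //.
    by rewrite -natrM ler_nat (leq_trans _ Kf_le) // leq_mul2r Z_le orbT.
  have nzr : ((1 - g%:R^-1) * n%:R) ^+ r <= (n - #|Z|)%:R ^+ r :> R.
    rewrite lerXn2r ?nnegrE // mulr_ge0 // subr_ge0.
    by case/andP: x_in.
  rewrite exprMn in nzr; have := le_trans (ler_wpM2r nr_ge0 bern) nzr.
  have := Edeg v; rewrite -/n; move: (n%:R ^+ r) ((n - #|Z|)%:R ^+ r) => x1 x2; lra.
have [M [ME trM D_small]] := n3_ge V E' (~: Z) n3_le V_dvd E'k E'deg.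
have MZ : [disjoint cover M & Z].
  rewrite disjoint_sym; apply: disjoint_bigcup => e eM.
  by have := subsetP ME e eM; rewrite inE disjoint_sym => /andP[].
pose S := ~: Z :\: cover M.
have SZ : [disjoint S & Z].
  rewrite -setI_eq0; apply/eqP/setP => v; rewrite in_setI in_setD in_setC in_set0.
  by case: (v \in Z); rewrite ?andbF.
have cover_eq : [set: V] = cover M :|: (S :|: Z).
  apply/setP => v; rewrite !in_setU in_setD in_setC in_setT.
  by case: (v \in cover M) => //=; case: (v \in Z).
have cM_S : cover M :&: S = set0.
  by apply/setP => v; rewrite in_setI in_setD in_set0; case: (v \in cover M).
have cM_SZ : [disjoint cover M & S :|: Z].
  by rewrite -setI_eq0 setIUr cM_S set0U setI_eq0.
have M_pm : pmatchable E (cover M).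
  exists M; split => //; apply: subset_trans ME _.
  by apply/subsetP => e; rewrite inE => /andP[].
have /dvdnP[l lE] : (r.+1 %| #|S|)%N.
  have cardV : #|V| = (#|cover M| + (#|S| + #|Z|))%N.
    have -> : #|V| = #|[set: V]| by rewrite cardsT.
    rewrite cover_eq cardsU disjoint_setI0 // cards0 subn0.
    by rewrite cardsU disjoint_setI0 // cards0 subn0.
  move: V_dvd; rewrite cardV (dvdn_addr _ (pmatchable_dvdn Ek M_pm)).
  by rewrite (dvdn_addl _ Z_dvd).
(* [eta] is [1 / (2 G)], so even the number of leftover vertices is at most [L]. *)
have l_le : (l <= L)%N.
  have lS : (l <= #|S|)%N by rewrite lE leq_pmulr.
  apply: leq_trans lS _.
  have : (#|S| * (2 * G) <= n)%N.
    move: D_small; rewrite -/S /eta mulrC ler_pdivlMr // -natrM ler_nat.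
    by [].
  have := ltn_ceil n G_gt0; rewrite -/L => lt1 le2.
  rewrite -ltnS -(ltn_pmul2r G_gt0); apply: leq_ltn_trans lt1.
  by apply: leq_trans le2; rewrite leq_mul2l leq_pmull ?orbT.
rewrite cover_eq; apply: pmatchableU => //.
apply: (@absorb_all V E r F l) => // x.
exact: leq_trans l_le (F_abs x).
Qed.

(** * From d-degrees to vertex degrees *)

Lemma bin_mul_bin (N K D : nat) : (D <= K <= N)%N ->
  ('C(N, D) * 'C(N - D, K - D) = 'C(N, K) * 'C(K, D))%N.
Proof.
move=> /andP[DK KN].
have DN := leq_trans DK KN.
have pos : (0 < D`! * (K - D)`! * (N - K)`!)%N by rewrite !muln_gt0 !fact_gt0.
apply/eqP; rewrite -(eqn_pmul2r pos); apply/eqP.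
have e1 := bin_fact DN; have e2 := bin_fact KN; have e3 := bin_fact DK.
have KDN : (K - D <= N - D)%N by lia.
have e4 := bin_fact KDN; rewrite (_ : N - D - (K - D) = N - K)%N in e4; last by lia.
transitivity N`!.
  rewrite -e1 -e4; ring.
rewrite -e2 -e3; ring.
Qed.

Lemma card_sets_containing (T : finType) (B : {set T}) (v : T) (d : nat) :
  v \in B ->
  #|[set S : {set T} | [&& v \in S, S \subset B & #|S| == d.+1]]| = 'C(#|B|.-1, d).
Proof.
move=> vB; have -> : #|B|.-1 = #|B :\ v| by rewrite (cardsD1 v B) vB.
rewrite -cards_draws.
have inj : {in [set A : {set T} | A \subset B :\ v & #|A| == d] &,
    injective (fun A => v |: A)}.
  move=> A A'; rewrite !inE => /andP[Av _] /andP[A'v _] AA'.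
  have notin (C : {set T}) : C \subset B :\ v -> v \notin C.
    by move=> Cv; apply/negP => /(subsetP Cv); rewrite !inE eqxx.
  by rewrite -(setU1K (notin A Av)) AA' setU1K // notin.
rewrite -(card_in_imset inj); apply: eq_card => S; apply/idP/imsetP.
  rewrite inE => /and3P[vS SB cardS]; exists (S :\ v); last by rewrite setD1K.
  rewrite inE setSD //=; move: cardS; rewrite (cardsD1 v S) vS add1n eqSS.
  by [].
move=> [A]; rewrite inE => /andP[AB /eqP cardA] ->.
have vA : v \notin A by apply/negP => /(subsetP AB); rewrite !inE eqxx.
rewrite inE !inE eqxx /= cardsU1 vA cardA add1n eqxx andbT subUset sub1set vB /=.
exact: subset_trans AB (subsetDl _ _).
Qed.

Lemma bigminn_le (I : finType) (P : pred I) (F : I -> nat) x i :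
  P i -> (\big[minn/x]_(j | P j) F j <= F i)%N.
Proof.
move=> Pi; have : i \in index_enum I by rewrite mem_index_enum.
elim: (index_enum I) => // j s IH; rewrite inE big_cons => /predU1P[<-|/IH le_i].
  by rewrite Pi geq_minl.
by case: ifP => // _; apply: leq_trans (geq_minr _ _) le_i.
Qed.

(** Both sides estimate the number of pairs [S \subset e] with [v \in S]; each edge through [v]
    contains exactly ['C(k - 1, d - 1)] such [S]. *)
Lemma vertex_degree_ge (k d : nat) (H : kgraph k) (v : vert H) : (0 < d <= k)%N ->
  (k <= #|vert H|)%N ->
  ('C(#|vert H| - 1, d - 1) * mindeg d H <=
   #|[set e in edges H | v \in e]| * 'C(k - 1, d - 1))%N.
Proof.
move=> /andP[d_gt0 dk] kn.
pose Sv := [set S : {set vert H} | (v \in S) && (#|S| == d)].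
have cardSv : #|Sv| = 'C(#|vert H| - 1, d - 1).
  have -> : Sv = [set S : {set vert H} | [&& v \in S, S \subset setT & #|S| == d.-1.+1]].
    by apply/setP => S; rewrite !inE subsetT prednK.
  by rewrite card_sets_containing ?inE // cardsT !subn1.
have cardSe e : e \in edges H -> v \in e ->
    #|[set S in Sv | S \subset e]| = 'C(k - 1, d - 1).
  move=> eH ve; have -> : [set S in Sv | S \subset e] =
      [set S : {set vert H} | [&& v \in S, S \subset e & #|S| == d.-1.+1]].
    by apply/setP => S; rewrite !inE prednK // -andbA [X in _ && X]andbC.
  by rewrite card_sets_containing // (edges_card eH) !subn1.
rewrite -cardSv -sum_nat_const.
apply: (@leq_trans (\sum_(S in Sv) deg S)).
  by apply: leq_sum => S; rewrite inE => /andP[_ cardS]; apply: bigminn_le.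
rewrite -sum_nat_const.
have -> : (\sum_(S in Sv) deg S =
    \sum_(S in Sv) \sum_(e in [set e in edges H | v \in e]) (S \subset e))%N.
  apply: eq_bigr => S; rewrite inE => /andP[vS _]; rewrite /deg -sum1_card.
  rewrite big_mkcond [RHS]big_mkcond; apply: eq_bigr => e _; rewrite !inE.
  case: (e \in edges H) => //=; case: (boolP (S \subset e)) => [/subsetP/(_ v vS) ->|_] //.
  by case: ifP.
rewrite exchange_big /=; apply: eq_leq; apply: eq_bigr => e; rewrite inE => /andP[eH ve].
rewrite -(cardSe e eH ve) -sum1_card big_mkcond [RHS]big_mkcond.
by apply: eq_bigr => S _; rewrite !inE; case: (_ && _); case: (S \subset e).
Qed.

Lemma tdeg_ge (V : finType) (E : {set {set V}}) (r : nat) (v : V) :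
  (forall e, e \in E -> #|e| = r.+1) ->
  (#|[set e in E | v \in e]| * r`! <= tdeg E r v)%N.
Proof.
move=> Ek; rewrite -sum_nat_const.
pose im (f : {ffun 'I_r -> V}) := v |: [set f i | i : 'I_r].
apply: (@leq_trans (\sum_(e in [set e in E | v \in e])
    #|[set f in [set f : {ffun 'I_r -> V} | im f \in E] | im f == e]|)).
  apply: leq_sum => e; rewrite inE => /andP[eE ve].
  have card_ev : #|e :\ v| = r by apply: succn_inj; rewrite -(Ek e eE) (cardsD1 v e) ve.
  have := card_inj_ffuns_on 'I_r (mem (e :\ v)).
  rewrite card_ev card_ord ffactnn => <-; apply: subset_leq_card; apply/subsetP => f.
  rewrite !inE => /andP[/ffun_onP f_on /injectiveP f_inj].
  suff imE : im f = e by rewrite imE eE eqxx.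
  rewrite -(setD1K ve) /im; congr (_ |: _); apply/eqP.
  rewrite eqEcard card_ev card_imset // card_ord leqnn andbT.
  by apply/subsetP => _ /imsetP[i _ ->]; apply: f_on.
rewrite /tdeg -/im -[leqRHS]sum1_card [leqRHS](partition_big im (mem [set e in E | v \in e])) /=.
  by apply: leq_sum => e _; rewrite sum1dep_card.
by move=> f; rewrite !inE => ->; rewrite eqxx.
Qed.

(** Only divergence matters: the surplus in the degree must eventually exceed the unit lost by
    rounding the bound to an integer. *)
Lemma bin_ge (N j : nat) : (0 < j < N)%N -> (N - j < 'C(N, j))%N.
Proof.
move=> /andP[j_gt0]; elim: N j j_gt0 => // N IH [//|j] _; rewrite ltnS leq_eqVlt.
move=> /predU1P[<-|lt_jN]; first by rewrite subSnn binSn.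
rewrite binS; case: j lt_jN => [|j] lt_jN.
  by rewrite bin0 bin1; lia.
have := IH j.+2 isT lt_jN; have : (0 < 'C(N, j.+1))%N by rewrite bin_gt0; lia.
lia.
Qed.

Lemma index_bounds (k d n n3 : nat) :
  (1 <= d)%N -> (2 * d <= k)%N -> (n3 + k.+1 <= n)%N ->
  [/\ (0 < d <= k)%N, (k < n)%N, (0 < k - d < n - d)%N &
      (n3 <= n - d - (k - d))%N] /\
  [/\ (d - 1 <= k - 1 <= n - 1)%N, (n - 1 - (d - 1) = n - d)%N &
      (k - 1 - (d - 1) = k - d)%N].
Proof. by move=> *; do !split; lia. Qed.

Unset Implicit Arguments.

Theorem theorem1p5 (R : realType) (k d : nat)
  (hk : (3 <= k)%N) (hd1 : (1 <= d)%N) (hdk : (2 * d <= k)%N) :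
  forall eps : R, 0 < eps ->
  exists n0 : nat, forall n : nat, (n0 <= n)%N -> (k %| n)%N ->
    (m_deg d k n)%:R <= (43%:R / 50%:R + eps) * 'C(n - d, k - d)%:R.
Proof.
move=> eps eps_gt0.
pose r := k.-1; have kE : k = r.+1 by rewrite /r prednK //; lia.
have r_gt0 : (0 < r)%N by lia.
pose e1 := Num.min eps 1.
have e1_gt0 : 0 < e1 by rewrite lt_min eps_gt0 ltr01.
have e1_le1 : e1 <= 1 by rewrite ge_min lexx orbT.
have e1_le : e1 <= eps by rewrite ge_min lexx.
have e14_gt0 : 0 < e1 / 4 by rewrite divr_gt0.
have e14_le1 : e1 / 4 <= 1 by lra.
have [n1 n1_ge] := tuple_perfect_matching r_gt0 e14_gt0 e14_le1.
have e18_gt0 : 0 < e1 / 8 by rewrite divr_gt0.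
have [n2 n2_ge] := ffact_asymp r.+1 e18_gt0.
have [n3 n3_ge] := exists_nat_ge (2 / e1).
exists (maxn n1 (maxn n2 (n3 + k.+1))) => n; rewrite !geq_max => /and3P[le1 le2 le3] k_dvd.
set B := (43 / 50 + eps) * 'C(n - d, k - d)%:R.
have B_ge0 : 0 <= B by rewrite mulr_ge0 //; lra.
rewrite /m_deg; case: ex_minnP => m _ m_min.
(* By minimality it is enough that the integer part of [B] forces a perfect matching. *)
apply: (@le_trans _ _ (Num.truncn B)%:R); last first.
  by case/andP: (truncn_itv B_ge0).
rewrite ler_nat; apply: m_min; apply/asboolP => H cardV deg_ge.
have [[d_in kn kd_in n3_le] [D_in nd_eq kd_eq]] := index_bounds hd1 hdk le3.
have n_gt0 : 0 < n%:R :> R by rewrite ltr0n (leq_ltn_trans _ kn).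
pose C : R := 'C(n - d, k - d)%:R.
have C_ge : n3%:R <= C.
  by rewrite ler_nat (leq_trans n3_le) // ltnW // bin_ge.
have C_ge2 : 2 <= e1 * C.
  rewrite mulrC -ler_pdivrMr //; exact: le_trans n3_ge C_ge.
have mindeg_ge : (43 / 50 + e1 / 2) * C <= (mindeg d H)%:R.
  have /andP[_ B_lt] := truncn_itv B_ge0.
  have : B < (mindeg d H)%:R + 1.
    by apply: lt_le_trans B_lt _; rewrite natr1 ler_nat.
  have : (43 / 50 + e1) * C <= B by rewrite /B ler_wpM2r //; lra.
  by lra.
have deg_v v : (43 / 50 + e1 / 2) * 'C(n - 1, r)%:R <=
    #|[set e in edges H | v \in e]|%:R.
  have := @vertex_degree_ge k d H v d_in; rewrite cardV => /(_ (ltnW kn)).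
  have rE : (k - 1)%N = r by rewrite /r subn1.
  have x_gt0 : 0 < 'C(k - 1, d - 1)%:R :> R by rewrite ltr0n bin_gt0; case/andP: D_in.
  have := bin_mul_bin D_in.
  rewrite nd_eq kd_eq.
  move=> /(congr1 (fun x => x%:R : R)); rewrite !natrM => binE.
  rewrite -(ler_nat R) !natrM => le_deg.
  rewrite -(ler_pM2r x_gt0) -rE; apply: le_trans le_deg.
  by rewrite -mulrA -binE mulrCA ler_wpM2l.
have tdeg_v v : (43 / 50 + e1 / 4) * #|vert H|%:R ^+ r <= (tdeg (edges H) r v)%:R.
  have Ek e : e \in edges H -> #|e| = r.+1 by move=> /edges_card ->; apply: kE.
  have := tdeg_ge v Ek; rewrite -(ler_nat R) natrM => tdeg_le; apply: le_trans tdeg_le.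
  apply: le_trans (ler_wpM2r (ler0n R r`!) (deg_v v)).
  rewrite -mulrA -natrM bin_ffact cardV.
  (* Taking one factor [n] off both sides turns the estimate for [n ^_ r.+1] into one for
     [(n - 1) ^_ r]. The surplus then falls from [e1 / 2] to [e1 / 4]. *)
  have ff : (1 - e1 / 8) * n%:R ^+ r <= ((n - 1) ^_ r)%:R.
    have := n2_ge n le2; rewrite exprS ffactnS natrM mulrCA ler_pM2l // subn1.
    by [].
  apply: le_trans (ler_wpM2l _ ff); last by lra.
  rewrite mulrA ler_wpM2r ?exprn_ge0 //.
  have : 0 <= e1 * (1 - e1) by rewrite mulr_ge0 ?subr_ge0 // ltW.
  by lra.
have [||||M [ME trM covM]] := n1_ge (vert H) (edges H).
- by rewrite cardV.
- by rewrite cardV -kE.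
- by move=> e /edges_card ->; apply: kE.
- exact: tdeg_v.
exists M; rewrite /perfect_matching /matching ME trM /=.
rewrite -cardsT -covM -(eqP trM) (eq_bigr (fun=> k)) ?sum_nat_const //.
by move=> e eM; apply: edges_card; apply: (subsetP ME).
Qed.
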